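(* Let $k$ be a field and let $E$ be a fractional Brauer configuration of type S with Nakayama automorphism $\sigma$. Then $\Lambda_E(-,\sigma(x))\cong D\Lambda_E(x,-)$ (as functors) for every object $x$ of $\Lambda_E$. Therefore the associated fractional Brauer configuration category $\Lambda_E$ is a locally bounded Frobenius category.
   Context: Fractional Brauer configuration. Let $G=\langle g\rangle$ be an infinite cyclic group. A fractional Brauer configuration (f-BC) is a quadruple $E=(E,P,L,d)$, where $E$ is a (finite or infinite) $G$-set, $P$ and $L$ are two partitions of $E$ ($P(e)$ and $L(e)$ denote the classes containing $e$), and $d:E\to\mathbb{Z}_{+}$ is a function to the positive integers, such that: (f1) $L(e)\subseteq P(e)$ and $P(e)$ is finite for each $e\in E$; (f2) if $L(e_1)=L(e_2)$ then $P(g\cdot e_1)=P(g\cdot e_2)$; (f3) if $e_1,e_2$ lie in the same $\langle g\rangle$-orbit then $d(e_1)=d(e_2)$; (f4) $P(e_1)=P(e_2)$ if and only if $P(g^{d(e_1)}\cdot e_1)=P(g^{d(e_2)}\cdot e_2)$; (f5) $L(e_1)=L(e_2)$ if and only if $L(g^{d(e_1)}\cdot e_1)=L(g^{d(e_2)}\cdot e_2)$; (f6) for all $e,h\in E$ the formal sequence $L(g^{d(e)-1}\cdot e)\cdots L(g\cdot e)L(e)$ is not a proper subsequence (of consecutive terms) of the formal sequence $L(g^{d(h)-1}\cdot h)\cdots L(g\cdot h)L(h)$. Standard sequences. A standard sequence is $p=(g^{n-1}\cdot e,\dots,g\cdot e,e)$ with $e\in E$, $0\le n\le d(e)$; for $n=0$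 it is the trivial sequence $()_e$; for $n=d(e)$ it is called full. Put $L(p)=L(g^{n-1}\cdot e)\cdots L(g\cdot e)L(e)$ if $n>0$ and $L(()_e)=1_{P(e)}$. Left complement: ${}^{\wedge}p=(g^{d(e)-1}\cdot e,\dots,g^{n}\cdot e)$ if $n<d(e)$ (including $n=0$), ${}^{\wedge}p=()_{g^{d(e)}\cdot e}$ if $n=d(e)$. Right complement: $p^{\wedge}=(g^{-1}\cdot e,\dots,g^{n-d(e)}\cdot e)$ if $n<d(e)$, $p^{\wedge}=()_e$ if $n=d(e)$. Write $p\equiv q$ if $L(p)=L(q)$ as formal sequences. For a set $\mathscr X$ of standard sequences, ${}^{\wedge}\mathscr X=\{{}^{\wedge}p\mid p\in\mathscr X\}$, $\mathscr X^{\wedge}=\{p^{\wedge}\mid p\in\mathscr X\}$, $[\mathscr X]=\{q \text{ standard}\mid q\equiv p\text{ for some }p\in\mathscr X\}$, and $[p]=[\{p\}]$. Type S. $E$ is of type S if moreover (f7): for all standard sequences $p\equiv q$, $[[{}^{\wedge}p]^{\wedge}]=[[{}^{\wedge}q]^{\wedge}]$ or $[{}^{\wedge}[p^{\wedge}]]=[{}^{\wedge}[q^{\wedge}]]$ (these two conditions are equivalent). Category. $Q_E$ is the quiver with vertices $P(e)$ and arrows $L(e):P(e)\to P(g\cdot e)$ ($e\in E$); paths are written right to left. $I_E$ is the ideal of the path category $kQ_E$ generated by: (fR1) $L(g^{d(e)-1-k}\cdot e)\cdots L(e)-L(g^{d(h)-1-k}\cdot h)\cdots L(h)$, where $0\le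 k\le\min\{d(e),d(h)\}$ is an integer, $P(e)=P(h)$ and $L(g^{d(e)-i}\cdot e)=L(g^{d(h)-i}\cdot h)$ for $1\le i\le k$; (fR2) paths $L(e_n)\cdots L(e_1)$ with $n>1$ and $\bigcap_{i=1}^n g^{n-i}\cdot L(e_i)=\emptyset$; (fR3) paths $L(g^{n-1}\cdot e)\cdots L(g\cdot e)L(e)$ with $n>d(e)$. $\Lambda_E=kQ_E/I_E$. The Nakayama automorphism $\sigma:E\to E$, $\sigma(e)=g^{d(e)}\cdot e$, induces an automorphism $\sigma$ of $\Lambda_E$ with $\sigma(P(e))=P(\sigma(e))$ and $\sigma(L(e))=L(\sigma(e))$. Locally bounded Frobenius category. A $k$-category $\Lambda$ is locally bounded if every $\Lambda(x,x)$ is local, distinct objects are non-isomorphic, and for each $x$, $\sum_{y}\dim_k\Lambda(x,y)<\infty$ and $\sum_y\dim_k\Lambda(y,x)<\infty$. A locally bounded category $\Lambda$ is Frobenius if for every object $x$ there are objects $y,z$ with $\Lambda(-,x)\cong D\Lambda(y,-)$ and $\Lambda(x,-)\cong D\Lambda(-,z)$, where $D=\mathrm{Hom}_k(-,k)$. *)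

(* Defs.v *)
From HB Require Import structures.
From mathcomp Require Import all_boot all_order all_algebra.
From mathcomp Require Import mathcomp_extra boolp classical_sets functions cardinality.
From mathcomp Require Import finmap.
From mathcomp Require Import monalg.

Set Implicit Arguments.
Unset Strict Implicit.
Unset Printing Implicit Defensive.

Import GRing.Theory.

Local Open Scope classical_set_scope.
Local Open Scope ring_scope.
Local Open Scope quotient_scope.

Section MkLinear.
Variables (k : fieldType) (U V W : lmodType k).

Definition mk_linear (f : U -> V) (f_linear : linear f) : {linear U -> V} :=
  HB.pack_for {linear U -> V} f (GRing.isLinear.Build k U V *:%R f f_linear).

Lemma linear_comp (g : V -> W) (f : U -> V) :
  linear g -> linear f -> linear (g \o f).
Proof. by move=> g_lin f_lin a u v; rewrite /= f_lin g_lin. Qed.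
End MkLinear.

Record subspace (k : fieldType) (V : lmodType k) := Subspace {
  subspace_set :> V -> Prop;
  subspace0 : subspace_set 0;
  subspaceP : forall (a : k) u v,
    subspace_set u -> subspace_set v -> subspace_set (a *: u + v) }.

Section LinearQuotient.
Variables (k : fieldType) (V : lmodType k) (W : subspace V).

Definition subspace_pred : {pred V} := [pred v | `[< W v >]].

Fact subspace_zmod_closed : zmod_closed subspace_pred.
Proof.
split=> [|u v /asboolP Wu /asboolP Wv]; apply/asboolP; first exact: subspace0.
by rewrite addrC -scaleN1r; apply: subspaceP.
Qed.

HB.instance Definition _ :=
  GRing.isZmodClosed.Build V subspace_pred subspace_zmod_closed.

Definition lquot : Type := Quotient.quot subspace_pred.

HB.instance Definition _ := GRing.Zmodule.on lquot.
HB.instance Definition _ := EqQuotient.on lquot.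

Definition lpi (v : V) : lquot := \pi_(Quotient.quot subspace_pred) v.

Lemma lpi_eq u v : lpi u = lpi v <-> W (u - v).
Proof.
split=> [/eqP|Wuv]; last apply/eqP; rewrite /lpi -Quotient.idealrBE.
  by move/asboolP.
exact/asboolP.
Qed.

Lemma lpi_surj (q : lquot) : exists v, q = lpi v.
Proof. by exists (repr q); rewrite /lpi reprK. Qed.

Lemma lpiB : {morph lpi : u v / u - v}.
Proof. by move=> u v; rewrite /lpi !piE. Qed.

Lemma lpiD : {morph lpi : u v / u + v}.
Proof. by move=> u v; rewrite /lpi !piE. Qed.

Definition lquot_scale (a : k) (q : lquot) : lquot := lpi (a *: repr q).

Lemma lquot_scaleE a v : lquot_scale a (lpi v) = lpi (a *: v).
Proof.
apply/lpi_eq; rewrite -scalerBr -[_ *: _]addr0.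
apply: subspaceP; last exact: subspace0.
by apply/lpi_eq; rewrite {1}/lpi reprK.
Qed.

Fact lquot_scaleA a b v :
  lquot_scale a (lquot_scale b v) = lquot_scale (a * b) v.
Proof. by have [u ->] := lpi_surj v; rewrite !lquot_scaleE scalerA. Qed.

Fact lquot_scale1 : left_id 1 lquot_scale.
Proof. by move=> v; have [u ->] := lpi_surj v; rewrite lquot_scaleE scale1r. Qed.

Fact lquot_scaleDr : right_distributive lquot_scale +%R.
Proof.
move=> a u v; have [u' ->] := lpi_surj u; have [v' ->] := lpi_surj v.
by rewrite -lpiD !lquot_scaleE scalerDr lpiD.
Qed.

Fact lquot_scaleDl v : {morph lquot_scale^~ v : a b / a + b}.
Proof.
by move=> a b; have [u ->] := lpi_surj v; rewrite !lquot_scaleE scalerDl lpiD.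
Qed.

HB.instance Definition _ := GRing.Zmodule_isLmodule.Build k lquot
  lquot_scaleA lquot_scale1 lquot_scaleDr lquot_scaleDl.

Lemma lpi_linear : linear lpi.
Proof. by move=> a u v; rewrite lpiD -lquot_scaleE. Qed.

HB.instance Definition _ := GRing.isLinear.Build k V lquot *:%R lpi lpi_linear.

End LinearQuotient.

Section Dual.
Variables (k : fieldType) (V : lmodType k).

Definition dual : Type := {linear V -> k^o}.

Definition dual_fun (f : dual) : V -> k^o := f.

Lemma dual_funP (f : dual) : linear (dual_fun f).
Proof. exact: linearP (f : {linear V -> k^o}). Qed.

Lemma dual_ext (f g : dual) : dual_fun f =1 dual_fun g -> f = g.
Proof.
case: f g => f [[fa] [fl]] [g [[ga] [gl]]] /= /funext.
rewrite /dual_fun /= => fg; subst g; congr GRing.Linear.Pack.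
by rewrite (Prop_irrelevance fa ga) (Prop_irrelevance fl gl).
Qed.

Definition mk_dual (f : V -> k^o) (f_linear : linear f) : dual :=
  mk_linear f_linear.

Fact dual0_linear : linear (fun _ : V => 0 : k^o).
Proof. by move=> a u v /=; rewrite scaler0 addr0. Qed.

Fact dualN_linear (f : dual) : linear (fun v => - dual_fun f v).
Proof. by move=> a u v /=; rewrite dual_funP opprD scalerN. Qed.

Fact dualD_linear (f g : dual) : linear (fun v => dual_fun f v + dual_fun g v).
Proof. by move=> a u v /=; rewrite !dual_funP scalerDr addrACA. Qed.

Fact dualZ_linear (a : k) (f : dual) : linear (fun v => a *: dual_fun f v).
Proof.
by move=> b u v /=; rewrite dual_funP scalerDr !scalerA (mulrC a b).
Qed.

Definition dual0 : dual := mk_dual dual0_linear.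
Definition dual_opp f : dual := mk_dual (dualN_linear f).
Definition dual_add f g : dual := mk_dual (dualD_linear f g).
Definition dual_scale a f : dual := mk_dual (dualZ_linear a f).

HB.instance Definition _ := gen_eqMixin dual.
HB.instance Definition _ := gen_choiceMixin dual.

Fact dual_addA : associative dual_add.
Proof. by move=> f g h; apply: dual_ext => v; apply: addrA. Qed.
Fact dual_addC : commutative dual_add.
Proof. by move=> f g; apply: dual_ext => v; apply: addrC. Qed.
Fact dual_add0 : left_id dual0 dual_add.
Proof. by move=> f; apply: dual_ext => v; apply: add0r. Qed.
Fact dual_addN : left_inverse dual0 dual_opp dual_add.
Proof. by move=> f; apply: dual_ext => v; apply: addNr. Qed.

HB.instance Definition _ :=
  GRing.isZmodule.Build dual dual_addA dual_addC dual_add0 dual_addN.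

Fact dual_scaleA a b f : dual_scale a (dual_scale b f) = dual_scale (a * b) f.
Proof. by apply: dual_ext => v; apply: scalerA. Qed.
Fact dual_scale1 : left_id 1 dual_scale.
Proof. by move=> f; apply: dual_ext => v; apply: scale1r. Qed.
Fact dual_scaleDr : right_distributive dual_scale +%R.
Proof. by move=> a f g; apply: dual_ext => v; apply: scalerDr. Qed.
Fact dual_scaleDl f : {morph dual_scale^~ f : a b / a + b}.
Proof. by move=> a b; apply: dual_ext => v; apply: scalerDl. Qed.

HB.instance Definition _ := GRing.Zmodule_isLmodule.Build k dual
  dual_scaleA dual_scale1 dual_scaleDr dual_scaleDl.

End Dual.

Section FreeModule.
Variables (k : fieldType) (K : choiceType) (V : lmodType k).

Definition mlift (F : K -> V) (g : {malg k[K]}) : V :=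
  \sum_(p <- msupp g) g@_p *: F p.

Lemma mliftEw (F : K -> V) (g : {malg k[K]}) (D : {fset K}) :
  (msupp g `<=` D)%fset -> mlift F g = \sum_(p <- D) g@_p *: F p.
Proof.
move=> gD; rewrite /mlift; apply: big_fset_incl => // p _ pg.
by rewrite mcoeff_outdom // scale0r.
Qed.

Lemma mlift_linear (F : K -> V) : linear (mlift F).
Proof.
move=> a g h; pose D := (msupp (a *: g + h) `|` (msupp g `|` msupp h))%fset.
have sub0 : (msupp (a *: g + h) `<=` D)%fset by rewrite fsubsetUl.
have sub1 : (msupp g `<=` D)%fset by rewrite /D fsetUCA fsubsetUl.
have sub2 : (msupp h `<=` D)%fset by rewrite /D fsetUA fsubsetUr.
rewrite (mliftEw F sub0) (mliftEw F sub1) (mliftEw F sub2).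
rewrite scaler_sumr -big_split /=; apply: eq_bigr => p _.
by rewrite mcoeffD mcoeffZ scalerDl scalerA.
Qed.

HB.instance Definition _ (F : K -> V) :=
  GRing.isLinear.Build k {malg k[K]} V *:%R (mlift F) (mlift_linear F).

Lemma mliftU (F : K -> V) p : mlift F << p >> = F p.
Proof.
rewrite (@mliftEw _ _ [fset p]%fset) ?msuppU_le //.
by rewrite big_seq_fset1 mcoeffUU scale1r.
Qed.

Lemma malg_ext (f g : {malg k[K]} -> V) : linear f -> linear g ->
  (forall p, f << p >> = g << p >>) -> f =1 g.
Proof.
move=> f_lin g_lin fg u.
pose f' := mk_linear f_lin; pose g' := mk_linear g_lin.
have E p : << u@_p *g p >> = u@_p *: << p >> :> {malg k[K]}.
  by apply/malgP => q; rewrite mcoeffZ !mcoeffU mulr_natr.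
have fZ a v : f' (a *: v) = a *: f' v by exact: linearZ_LR.
have gZ a v : g' (a *: v) = a *: g' v by exact: linearZ_LR.
rewrite -[LHS]/(f' u) -[RHS]/(g' u) [u]monalgE !raddf_sum.
apply: eq_bigr => p _; rewrite E -[LHS]/(f' _) -[RHS]/(g' _) fZ gZ.
by congr (_ *: _); apply: fg.
Qed.

End FreeModule.

Record kcat (k : fieldType) := KCat {
  kobj :> Type;
  khom : kobj -> kobj -> lmodType k;
  kid : forall x, khom x x;
  kcomp : forall x y z, khom y z -> khom x y -> khom x z;
  kcompA : forall x y z t (h : khom z t) (g : khom y z) (f : khom x y),
    kcomp h (kcomp g f) = kcomp (kcomp h g) f;
  kcomp1f : forall x y (f : khom x y), kcomp (kid y) f = f;
  kcompf1 : forall x y (f : khom x y), kcomp f (kid x) = f;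
  kcomp_linear : forall x y z (g : khom y z),
    linear (fun f : khom x y => kcomp g f);
  kcomp_linearl : forall x y z (f : khom x y),
    linear (fun g : khom y z => kcomp g f) }.

Arguments kid {k _} x.
Arguments kcomp {k _ x y z} g f.
Notation "g \oc f" := (kcomp g f) (at level 40, left associativity).

Section Modules.
Variables (k : fieldType) (C : kcat k).

Record covariant_functor := Covar {
  cov_obj :> C -> lmodType k;
  cov_map : forall x y, khom x y -> cov_obj x -> cov_obj y;
  cov_linear : forall x y (f : khom x y), linear (cov_map f);
  cov_map_linear : forall x y (u : cov_obj x),
    linear (fun f : khom x y => cov_map f u);
  cov_map1 : forall x (u : cov_obj x), cov_map (kid x) u = u;
  cov_mapM : forall x y z (g : khom y z) (f : khom x y) (u : cov_obj x),
    cov_map (g \oc f) u = cov_map g (cov_map f u) }.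

Record contravariant_functor := Contra {
  con_obj :> C -> lmodType k;
  con_map : forall x y, khom x y -> con_obj y -> con_obj x;
  con_linear : forall x y (f : khom x y), linear (con_map f);
  con_map_linear : forall x y (u : con_obj y),
    linear (fun f : khom x y => con_map f u);
  con_map1 : forall x (u : con_obj x), con_map (kid x) u = u;
  con_mapM : forall x y z (g : khom y z) (f : khom x y) (u : con_obj z),
    con_map (g \oc f) u = con_map f (con_map g u) }.

Definition covar_iso (M N : covariant_functor) : Prop :=
  exists phi : forall x, {linear M x -> N x},
    (forall x, bijective (phi x)) /\
    (forall x y (f : khom x y) (u : M x),
       phi y (cov_map f u) = cov_map f (phi x u)).

Definition contra_iso (M N : contravariant_functor) : Prop :=
  exists phi : forall x, {linear M x -> N x},
    (forall x, bijective (phi x)) /\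
    (forall x y (f : khom x y) (u : M y),
       phi x (con_map f u) = con_map f (phi y u)).

Definition hom_from (x : C) : covariant_functor :=
  @Covar (fun y => khom x y) (fun y z (f : khom y z) u => f \oc u)
    (fun y z f => @kcomp_linear k C x y z f)
    (fun y z u => @kcomp_linearl k C x y z u)
    (fun y u => kcomp1f u)
    (fun y z t g f u => esym (kcompA g f u)).

Definition hom_to (x : C) : contravariant_functor :=
  @Contra (fun y => khom y x) (fun y z (f : khom y z) u => u \oc f)
    (fun y z f => @kcomp_linearl k C y z x f)
    (fun y z u => @kcomp_linear k C y z x u)
    (fun y u => kcompf1 u)
    (fun y z t g f u => kcompA u g f).

Definition dual_covar_map (M : covariant_functor) x y (f : khom x y) (u : dual (M y)) :
    dual (M x) :=
  mk_dual (linear_comp (dual_funP u) (@cov_linear M x y f)).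

Definition dual_contra_map (M : contravariant_functor) x y (f : khom x y) (u : dual (M x)) :
    dual (M y) :=
  mk_dual (linear_comp (dual_funP u) (@con_linear M x y f)).

Program Definition dual_covar (M : covariant_functor) : contravariant_functor :=
  @Contra (fun x => dual (M x)) (dual_covar_map (M := M)) _ _ _ _.
Next Obligation. by move=> a u v; apply: dual_ext. Qed.
Next Obligation.
move=> a f g; apply: dual_ext => v.
by rewrite /dual_fun /= cov_map_linear dual_funP.
Qed.
Next Obligation.
by apply: dual_ext => v; rewrite /dual_fun /= cov_map1.
Qed.
Next Obligation.
by apply: dual_ext => v; rewrite /dual_fun /= cov_mapM.
Qed.

Program Definition dual_contra (M : contravariant_functor) : covariant_functor :=
  @Covar (fun x => dual (M x)) (dual_contra_map (M := M)) _ _ _ _.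
Next Obligation. by move=> a u v; apply: dual_ext. Qed.
Next Obligation.
move=> a f g; apply: dual_ext => v.
by rewrite /dual_fun /= con_map_linear dual_funP.
Qed.
Next Obligation.
by apply: dual_ext => v; rewrite /dual_fun /= con_map1.
Qed.
Next Obligation.
by apply: dual_ext => v; rewrite /dual_fun /= con_mapM.
Qed.

End Modules.

Section LocallyBounded.
Variables (k : fieldType) (C : kcat k).

Definition right_ideal (x : C) (I : set (khom x x)) : Prop :=
  [/\ I 0, forall f g, I f -> I g -> I (f - g)
    & forall f g, I f -> I (f \oc g)].

Definition maximal_right_ideal (x : C) (I : set (khom x x)) : Prop :=
  [/\ right_ideal I, I <> setT
    & forall J, right_ideal J -> I `<=` J -> J <> setT -> J = I].

Definition local_endo (x : C) : Prop :=
  exists! I : set (khom x x), maximal_right_ideal I.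

Definition isomorphic_obj (x y : C) : Prop :=
  exists (f : khom x y) (g : khom y x), g \oc f = kid x /\ f \oc g = kid y.

Definition has_dim (V : lmodType k) (n : nat) : Prop :=
  exists phi : {linear V -> 'rV[k]_n}, bijective phi.

(* A sum of natural numbers is finite when almost all its terms vanish. *)
Definition finite_total_dim (I : Type) (V : I -> lmodType k) : Prop :=
  exists d : I -> nat,
    (forall i, has_dim (V i) (d i)) /\ finite_set [set i | d i <> 0%N].

Definition locally_bounded : Prop :=
  [/\ forall x : C, local_endo x,
      forall x y : C, isomorphic_obj x y -> x = y,
      forall x : C, finite_total_dim (fun y => khom x y)
    & forall x : C, finite_total_dim (fun y => khom y x)].

Definition frobenius : Prop :=
  forall x : C, exists y z : C,
    contra_iso (hom_to x) (dual_covar (hom_from y)) /\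
    covar_iso (hom_from x) (dual_contra (hom_to z)).

Definition locally_bounded_frobenius : Prop := locally_bounded /\ frobenius.

End LocallyBounded.

Section QuotientCategory.
Variables (k : fieldType) (C : kcat k).
Variable R : forall x y : C, khom x y -> Prop.

Inductive ideal_gen : forall x y : C, khom x y -> Prop :=
| Ideal_gen x y (f : khom x y) : R f -> ideal_gen f
| Ideal_zero x y : ideal_gen (0 : khom x y)
| Ideal_lin x y (a : k) (f g : khom x y) :
    ideal_gen f -> ideal_gen g -> ideal_gen (a *: f + g)
| Ideal_compl x y z (g : khom y z) (f : khom x y) :
    ideal_gen f -> ideal_gen (g \oc f)
| Ideal_compr x y z (g : khom y z) (f : khom x y) :
    ideal_gen g -> ideal_gen (g \oc f).

Definition ideal_space (x y : C) : subspace (khom x y) :=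
  Subspace (Ideal_zero x y) (@Ideal_lin x y).

Definition qhom (x y : C) : lmodType k := lquot (ideal_space x y).

Definition qmap (x y : C) (f : khom x y) : qhom x y := lpi (ideal_space x y) f.

Definition qcomp (x y z : C) (g : qhom y z) (f : qhom x y) : qhom x z :=
  qmap (repr g \oc repr f).

Lemma qmap_eq (x y : C) (f g : khom x y) :
  qmap f = qmap g <-> ideal_gen (f - g).
Proof. exact: lpi_eq. Qed.

Lemma qmap_surj (x y : C) (f : qhom x y) : exists f', f = qmap f'.
Proof. exact: lpi_surj. Qed.

Lemma qmap_repr (x y : C) (f : qhom x y) : qmap (repr f) = f.
Proof. by rewrite /qmap /lpi reprK. Qed.

Lemma qmapM (x y z : C) (g : khom y z) (f : khom x y) :
  qcomp (qmap g) (qmap f) = qmap (g \oc f).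
Proof.
have If : ideal_gen (repr (qmap f) - f) by apply/qmap_eq; rewrite qmap_repr.
have Ig : ideal_gen (repr (qmap g) - g) by apply/qmap_eq; rewrite qmap_repr.
apply/qmap_eq; set f' := repr _ in If *; set g' := repr _ in Ig *.
have -> : g' \oc f' - g \oc f = 1 *: (g' \oc (f' - f)) + (g' - g) \oc f.
  have -> : g' \oc (f' - f) = g' \oc f' - g' \oc f.
    exact: (raddfB (mk_linear (@kcomp_linear k C x y z g'))).
  have -> : (g' - g) \oc f = g' \oc f - g \oc f.
    exact: (raddfB (mk_linear (@kcomp_linearl k C x y z f))).
  by rewrite scale1r addrA subrK.
by apply: Ideal_lin; [apply: Ideal_compl | apply: Ideal_compr].
Qed.

Lemma qmap_linear (x y : C) : linear (@qmap x y).
Proof. exact: lpi_linear. Qed.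

Program Definition quot_cat : kcat k :=
  @KCat k C qhom (fun x => qmap (kid x)) qcomp _ _ _ _ _.
Next Obligation.
have [h' ->] := qmap_surj h; have [g' ->] := qmap_surj g.
by have [f' ->] := qmap_surj f; rewrite !qmapM kcompA.
Qed.
Next Obligation.
by have [f' ->] := qmap_surj f; rewrite !qmapM kcomp1f.
Qed.
Next Obligation.
by have [f' ->] := qmap_surj f; rewrite !qmapM kcompf1.
Qed.
Next Obligation.
move=> a u v; have [g' ->] := qmap_surj g.
have [u' ->] := qmap_surj u; have [v' ->] := qmap_surj v.
by rewrite -qmap_linear !qmapM kcomp_linear qmap_linear.
Qed.
Next Obligation.
move=> a u v; have [f' ->] := qmap_surj f.
have [u' ->] := qmap_surj u; have [v' ->] := qmap_surj v.
by rewrite -qmap_linear !qmapM kcomp_linearl qmap_linear.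
Qed.

End QuotientCategory.

Record quiver := Quiver {
  qvertex : choiceType;
  qarrow : choiceType;
  qsource : qarrow -> qvertex;
  qtarget : qarrow -> qvertex }.

Section PathCategory.
Variables (k : fieldType) (Q : quiver).

(* Paths are written right to left: the arrow s`_0 is the last one. *)
Fixpoint is_path (x : qvertex Q) (s : seq (qarrow Q)) (y : qvertex Q) : bool :=
  if s is a :: s' then (qtarget a == y) && is_path x s' (qsource a) else x == y.

Record qpath (x y : qvertex Q) := QPath {
  qseq :> seq (qarrow Q);
  qpathP : is_path x qseq y }.

HB.instance Definition _ x y := [isSub for @qseq x y].
HB.instance Definition _ x y := [Choice of qpath x y by <:].

Lemma is_path_cat x y z s t :
  is_path y s z -> is_path x t y -> is_path x (s ++ t) z.
Proof.
elim: s z => [|a s IHs] z /= => [/eqP-> //|/andP[-> ys xt]] /=.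
exact: IHs.
Qed.

Definition qpath1 (x : qvertex Q) : qpath x x := @QPath x x [::] (eqxx x).

Definition qpath_cat x y z (p : qpath y z) (q : qpath x y) : qpath x z :=
  QPath (is_path_cat (qpathP p) (qpathP q)).

Definition kpath_hom (x y : qvertex Q) : lmodType k := {malg k[qpath x y]}.

Definition kpath_comp x y z (g : kpath_hom y z) (f : kpath_hom x y) :
    kpath_hom x z :=
  mlift (fun p => mlift (fun q => << qpath_cat p q >> : kpath_hom x z) f) g.

Lemma kpath_comp_linear x y z (g : kpath_hom y z) :
  linear (fun f : kpath_hom x y => kpath_comp g f).
Proof.
move=> a u v; rewrite /kpath_comp /mlift scaler_sumr -big_split /=.
apply: eq_bigr => p _; rewrite -!/(mlift _ _) mlift_linear scalerDr !scalerA.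
by rewrite mulrC.
Qed.

Lemma kpath_comp_linearl x y z (f : kpath_hom x y) :
  linear (fun g : kpath_hom y z => kpath_comp g f).
Proof. exact: mlift_linear. Qed.

Lemma kpath_compU x y z (p : qpath y z) (q : qpath x y) :
  kpath_comp << p >> << q >> = << qpath_cat p q >>.
Proof. by rewrite /kpath_comp !mliftU. Qed.

Program Definition path_cat : kcat k :=
  @KCat k (qvertex Q) kpath_hom (fun x => << qpath1 x >>) kpath_comp _ _ _
    kpath_comp_linear kpath_comp_linearl.
Next Obligation.
have lin := (kpath_comp_linear, kpath_comp_linearl).
move: f; apply: malg_ext => [a u v|a u v|r]; rewrite ?lin //.
move: g; apply: malg_ext => [a u v|a u v|q]; rewrite ?lin //.
move: h; apply: malg_ext => [a u v|a u v|p]; rewrite ?lin //.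
rewrite !kpath_compU; congr << _ >>; apply: val_inj; exact: catA.
Qed.
Next Obligation.
move: f; apply: malg_ext => [a u v|a u v|p] //; first by rewrite kpath_comp_linear.
by rewrite kpath_compU; congr << _ >>; apply: val_inj.
Qed.
Next Obligation.
move: f; apply: malg_ext => [a u v|a u v|p] //; first by rewrite kpath_comp_linearl.
by rewrite kpath_compU; congr << _ >>; apply: val_inj; apply: cats0.
Qed.

End PathCategory.

(* The formal sequence L(g^(n-1) e) ... L(g e) L(e); [g i] is the action of
   the i-th power of the generator. *)
Definition class_seq (E : Type) (g : int -> E -> E) (L : E -> set E)
    (e : E) (n : nat) : seq (set E) :=
  [seq L (g i%:Z e) | i : nat <- rev (iota 0 n)].

(* [C e] is the class of e in a partition of E. *)
Definition partition_classes (E : Type) (C : E -> set E) : Prop :=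
  (forall e, C e e) /\ (forall e h, C e h -> C h = C e).

Record fbc := Fbc {
  fcar :> Type;
  gact : int -> fcar -> fcar;
  fP : fcar -> set fcar;
  fL : fcar -> set fcar;
  fd : fcar -> nat;
  gact0 : forall e, gact 0 e = e;
  gactD : forall m n e, gact (m + n) e = gact m (gact n e);
  fP_partition : partition_classes fP;
  fL_partition : partition_classes fL;
  fd_gt0 : forall e, (0 < fd e)%N;
  fbc1 : forall e, fL e `<=` fP e /\ finite_set (fP e);
  fbc2 : forall e1 e2, fL e1 = fL e2 -> fP (gact 1 e1) = fP (gact 1 e2);
  fbc3 : forall e1 e2, (exists n, e2 = gact n e1) -> fd e1 = fd e2;
  fbc4 : forall e1 e2, fP e1 = fP e2 <->
    fP (gact (fd e1)%:Z e1) = fP (gact (fd e2)%:Z e2);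
  fbc5 : forall e1 e2, fL e1 = fL e2 <->
    fL (gact (fd e1)%:Z e1) = fL (gact (fd e2)%:Z e2);
  fbc6 : forall e h,
    let s := class_seq gact fL e (fd e) in
    let t := class_seq gact fL h (fd h) in
    ~~ (infix s t && (s != t)) }.

Section StandardSequences.
Variable E : fbc.

(* The pair (e, n) stands for the sequence (g^(n-1) e, ..., g e, e), and for
   the trivial sequence at e when n = 0. *)
Definition preseq : Type := (E * nat)%type.

Definition standard (p : preseq) : Prop := (p.2 <= fd p.1)%N.

Definition formal (p : preseq) : set E + seq (set E) :=
  if p.2 == 0%N then inl (fP p.1) else inr (class_seq (@gact E) (@fL E) p.1 p.2).

Definition lcompl (p : preseq) : preseq :=
  (gact p.2%:Z p.1, (fd p.1 - p.2)%N).

Definition rcompl (p : preseq) : preseq :=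
  (gact (p.2%:Z - (fd p.1)%:Z) p.1, (fd p.1 - p.2)%N).

Definition std_closure (X : set preseq) : set preseq :=
  [set q | standard q /\ exists2 p, X p & formal q = formal p].

Definition type_S : Prop :=
  forall p q, standard p -> standard q -> formal p = formal q ->
    std_closure (rcompl @` std_closure [set lcompl p]) =
      std_closure (rcompl @` std_closure [set lcompl q])
    \/ std_closure (lcompl @` std_closure [set rcompl p]) =
      std_closure (lcompl @` std_closure [set rcompl q]).

End StandardSequences.

Section FbcCategory.
Variables (k : fieldType) (E : fbc).

Definition fbc_vertex : Type := {x : set E | `[< range (@fP E) x >]}.
Definition fbc_arrow : Type := {a : set E | `[< range (@fL E) a >]}.

Definition vertex_of (e : E) : fbc_vertex :=
  exist _ (fP e) (asboolT (imageT (@fP E) e)).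

Definition arrow_of (e : E) : fbc_arrow :=
  exist _ (fL e) (asboolT (imageT (@fL E) e)).

Lemma vertex_ofP (x : fbc_vertex) : exists e, x = vertex_of e.
Proof.
have [e _ eP] := asboolW (valP x).
by exists e; apply: val_inj; rewrite /= eP.
Qed.

Lemma arrow_ofP (a : fbc_arrow) : exists e, a = arrow_of e.
Proof.
have [e _ eL] := asboolW (valP a).
by exists e; apply: val_inj; rewrite /= eL.
Qed.

Definition arrow_repr (a : fbc_arrow) : E := projT1 (cid (arrow_ofP a)).

(* By fbc_source_of and fbc_target_of below, the source and the target of an
   arrow do not depend on the chosen representative of the class. *)
Definition fbc_source (a : fbc_arrow) : fbc_vertex := vertex_of (arrow_repr a).

Definition fbc_target (a : fbc_arrow) : fbc_vertex :=
  vertex_of (gact 1 (arrow_repr a)).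

Lemma arrow_repr_of e : fL (arrow_repr (arrow_of e)) = fL e.
Proof. by rewrite /arrow_repr; case: cid => h /= /(congr1 val) /= ->. Qed.

Lemma fP_of_fL (e h : E) : fL e = fL h -> fP e = fP h.
Proof.
move=> eh; apply: (fP_partition E).2; apply: (fbc1 h).1.
by rewrite -eh; apply: (fL_partition E).1.
Qed.

Lemma fbc_source_of e : fbc_source (arrow_of e) = vertex_of e.
Proof. by apply: val_inj; apply: fP_of_fL; apply: arrow_repr_of. Qed.

Lemma fbc_target_of e : fbc_target (arrow_of e) = vertex_of (gact 1 e).
Proof. by apply: val_inj; apply: fbc2; apply: arrow_repr_of. Qed.

Definition fbc_quiver : quiver := Quiver fbc_source fbc_target.

Definition path_classes (x y : qvertex fbc_quiver) (p : qpath x y) :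
    seq (set E) := [seq val a | a <- qseq p].

Definition fbc_rel1 (x y : path_cat k fbc_quiver) (f : khom x y) : Prop :=
  exists (e h : E) (m : nat) (p q : qpath x y),
    [/\ (m <= minn (fd e) (fd h))%N,
        x = vertex_of e /\ x = vertex_of h,
        (forall i : nat, (1 <= i <= m)%N ->
          fL (gact ((fd e)%:Z - i%:Z) e) = fL (gact ((fd h)%:Z - i%:Z) h)),
        path_classes p = class_seq (@gact E) (@fL E) e (fd e - m) /\
        path_classes q = class_seq (@gact E) (@fL E) h (fd h - m)
      & f = << p >> - << q >>].

(* The entry of index j of a path L(e_n) ... L(e_1) is L(e_(n-j)). *)
Definition fbc_rel2 (x y : path_cat k fbc_quiver) (f : khom x y) : Prop :=
  exists p : qpath x y,
    [/\ (1 < size p)%N,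
        \bigcap_(j in [set j | (j < size p)%N])
          (gact j%:Z @` nth set0 (path_classes p) j) = set0
      & f = << p >>].

Definition fbc_rel3 (x y : path_cat k fbc_quiver) (f : khom x y) : Prop :=
  exists (e : E) (n : nat) (p : qpath x y),
    [/\ (fd e < n)%N, path_classes p = class_seq (@gact E) (@fL E) e n
      & f = << p >>].

Definition fbc_rel (x y : path_cat k fbc_quiver) (f : khom x y) : Prop :=
  [\/ fbc_rel1 f, fbc_rel2 f | fbc_rel3 f].

Definition fbc_cat : kcat k := quot_cat fbc_rel.

Definition nakayama (e : E) : E := gact (fd e)%:Z e.

Lemma nakayama_class e : nakayama @` fP e = fP (nakayama e).
Proof.
have [Prefl Peq] := fP_partition E; apply/seteqP; split=> [_ [h eh <-]|h hP].
  have /(fbc4 h e).1 := Peq _ _ eh; rewrite -/(nakayama h) -/(nakayama e) => <-.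
  exact: Prefl.
pose h0 := gact (- (fd h)%:Z) h.
have dh0 : fd h0 = fd h by apply/esym/fbc3; exists (- (fd h)%:Z).
have sh0 : nakayama h0 = h by rewrite /nakayama dh0 -gactD subrr gact0.
exists h0 => //; have <- : fP h0 = fP e; last exact: Prefl.
by apply/fbc4; rewrite -/(nakayama h0) -/(nakayama e) sh0; apply: Peq.
Qed.

Fact nakayama_obj_subproof (x : fbc_vertex) :
  `[< range (@fP E) (nakayama @` val x) >].
Proof.
have [e ->] := vertex_ofP x; apply/asboolP => /=.
by rewrite nakayama_class; apply: imageT.
Qed.

(* The image of the class P(e) under the Nakayama automorphism is P(nakayama e)
   by nakayama_class. *)
Definition nakayama_obj (x : fbc_cat) : fbc_cat :=
  exist _ (nakayama @` val (x : fbc_vertex)) (nakayama_obj_subproof x).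

Lemma nakayama_obj_of e : nakayama_obj (vertex_of e) = vertex_of (nakayama e).
Proof. by apply: val_inj; apply: nakayama_class. Qed.

End FbcCategory.

(* Main.v *)
Require Import Defs.
From mathcomp Require Import all_boot all_order all_algebra.
From mathcomp Require Import boolp classical_sets functions cardinality.
From mathcomp Require Import monalg zify.

Set Implicit Arguments.
Unset Strict Implicit.
Unset Printing Implicit Defensive.

Import GRing.Theory.

Local Open Scope classical_set_scope.
Local Open Scope ring_scope.

(** Every path of the quiver is zero in the quotient category, unless it is the
    arrow string of a standard sequence: fbc_rel2 kills the paths that do not
    follow a single orbit, and fbc_rel3 those that do but are too long. Since the
    classes P(e) are finite, each object is the source, and the target, of only
    finitely many standard paths (standard_or_zero, standard_starts_finite).

    The duality comes from a trace. Let the trace of a path be 1 if the path is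
    the arrow string of a full sequence, and 0 otherwise. The whole difficulty
    is that this descends to the quotient: fbc_rel1 identifies strings with a
    common left complement, and such strings must be interchangeable inside a
    full string. This is exactly what condition type_S gives (full_exchange). It is
    also where fbc6 enters, because it prevents a full string from containing
    an overlong one.

    Composition followed by the trace pairs the morphisms y -> sigma(x) with the
    morphisms x -> y. A standard path p and its left complement compose to a
    full string. Conversely, if the left complement of p composes with p' to a
    full string, then p and p' have a common left complement and are identified
    by fbc_rel1. So the left complement of p is dual to p among the standard
    paths x -> y, and right complements do the same on the other side
    (standard_classes_left_dual, standard_classes_right_dual). Hence the pairing
    is perfect, which gives both natural isomorphisms, and the finite dimension
    of the morphism spaces. As sigma is surjective on objects, the category is
    Frobenius.

    For locality there is a second form, the augmentation, which is 1 on
    trivial paths and 0 on all others. It is multiplicative, so isomorphic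
    objects are joined by a trivial path. Since long paths vanish, a right
    ideal of an endomorphism ring which is not contained in the kernel of the
    augmentation is everything (right_ideal_full), and that kernel is therefore
    the only maximal right ideal. *)

(** * Pairings with dual families *)

Section LinearMaps.
Variables (k : fieldType) (V W : lmodType k) (f : V -> W).
Hypothesis f_linear : linear f.

Lemma linear_map0 : f 0 = 0.
Proof. exact: (raddf0 (mk_linear f_linear)). Qed.

Lemma linear_mapB u v : f (u - v) = f u - f v.
Proof. exact: (raddfB (mk_linear f_linear)). Qed.

Lemma linear_mapZ c u : f (c *: u) = c *: f u.
Proof. by rewrite -[c *: u]addr0 f_linear linear_map0 addr0. Qed.

Lemma linear_map_sum (I : Type) (r : seq I) (F : I -> V) :
  f (\sum_(i <- r) F i) = \sum_(i <- r) f (F i).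
Proof. exact: (raddf_sum (mk_linear f_linear)). Qed.

End LinearMaps.

Section DualFamilies.
Variables (k : fieldType) (U V : lmodType k) (beta : U -> V -> k^o).
Hypothesis beta_linearl : forall v, linear (fun u => beta u v).

(** The subspaces of W form the quantifier instead of linear combinations, so
    that a spanning statement is used as an induction principle. *)
Definition spanning (W : lmodType k) (A : set W) : Prop :=
  forall S : subspace W, (forall a, A a -> S a) -> forall u, S u.

Definition has_dual_vectors (A : set U) : Prop := forall a, A a ->
  exists b : V, forall a', A a' -> beta a' b = (a' == a)%:R.

(** Dual vectors make the elements of A linearly independent, so the coordinates
    on the enumeration of A are the values of the pairing against them: the
    identity holds on A and is linear in u. *)
Lemma dual_coordinates (A : set U) :
    finite_set A -> spanning A -> has_dual_vectors A ->
  exists n (a : 'I_n -> U) (b : 'I_n -> V),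
    [/\ forall i, A (a i), forall i j, beta (a i) (b j) = (i == j)%:R
      & forall u, u = \sum_i beta u (b i) *: a i].
Proof.
move=> /finite_seqP[s0 As0] Aspan Adual; pose s := undup s0.
have As a : A a <-> a \in s by rewrite mem_undup As0.
have s_uniq : uniq s by apply: undup_uniq.
pose a (i : 'I_(size s)) := tnth (in_tuple s) i.
have Aa i : A (a i) by apply/As; apply: mem_tnth.
have a_inj i j : (a i == a j) = (i == j).
  by rewrite /a !(tnth_nth 0) nth_uniq // ?ltn_ord.
have [b bE] := choice (fun i => Adual _ (Aa i)).
exists (size s), a, b; split=> // [i j|]; first by rewrite bE // a_inj.
have S0 : 0 = \sum_i beta 0 (b i) *: a i.
  rewrite big1 // => i _.
  by rewrite (linear_map0 (beta_linearl (b i))) scale0r.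
have SP (c : k) u v : u = \sum_i beta u (b i) *: a i ->
    v = \sum_i beta v (b i) *: a i ->
    c *: u + v = \sum_i beta (c *: u + v) (b i) *: a i.
  move=> {1}-> {1}->; rewrite scaler_sumr -big_split; apply: eq_bigr => i _ /=.
  by rewrite beta_linearl scalerDl scalerA.
apply: (Aspan (Subspace S0 SP)) => u /= /As us.
have [i ->] : exists i, u = a i.
  have ui : (index u s < size s)%N by rewrite index_mem.
  by exists (Ordinal ui); rewrite /a (tnth_nth 0) /= nth_index.
rewrite (bigD1 i) //= bE // eqxx scale1r big1 ?addr0 // => j ji.
by rewrite bE // a_inj eq_sym (negPf ji) scale0r.
Qed.

Lemma dual_has_dim (A : set U) :
    finite_set A -> spanning A -> has_dual_vectors A ->
  exists n, has_dim U n /\ (n <> 0%N -> A !=set0).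
Proof.
move=> Afin Aspan Adual.
have [n [a [b [Aa ab aE]]]] := dual_coordinates Afin Aspan Adual.
exists n; split; last by case: n a {b ab aE} Aa => // n a Aa _; exists (a ord0).
have phi_lin : linear (fun u => \row_i (beta u (b i) : k)).
  by move=> c u v; apply/rowP => i; rewrite !mxE beta_linearl.
exists (mk_linear phi_lin), (fun r : 'rV_n => \sum_i r 0 i *: a i).
  by move=> u /=; rewrite {2}[u]aE; apply: eq_bigr => i _; rewrite mxE.
move=> r; apply/rowP => j /=; rewrite mxE.
rewrite (linear_map_sum (beta_linearl (b j))) (bigD1 j) //= big1 => [|i ij].
  by rewrite (linear_mapZ (beta_linearl (b j))) ab eqxx addr0; apply: mulr1.
by rewrite (linear_mapZ (beta_linearl (b j))) ab (negPf ij) scaler0.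
Qed.

End DualFamilies.

Section PerfectPairing.
Variables (k : fieldType) (U V : lmodType k) (beta : U -> V -> k^o).
Hypothesis beta_linearl : forall v, linear (fun u => beta u v).
Hypothesis beta_linearr : forall u, linear (beta u).

Definition pairing_map (u : U) : dual V := mk_dual (beta_linearr u).

Lemma pairing_map_linear : linear pairing_map.
Proof. by move=> c u v; apply: dual_ext => w; apply: beta_linearl. Qed.

(** The coordinates of u on A are values of the functional attached to u, hence
    injectivity; the inverse sends a functional to the combination of the
    vectors dual to B whose coefficients are its values on B. *)
Lemma pairing_map_bijective (A : set U) (B : set V) :
    finite_set A -> spanning A -> has_dual_vectors beta A ->
    finite_set B -> spanning B -> has_dual_vectors (fun v u => beta u v) B ->
  bijective (mk_linear pairing_map_linear).
Proof.
move=> Afin Aspan Adual Bfin Bspan Bdual.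
have [n [a [b [_ ab aE]]]] := dual_coordinates beta_linearl Afin Aspan Adual.
have [m [b' [a' [_ ab' bE]]]] :=
  @dual_coordinates _ _ _ (fun v u => beta u v) beta_linearr B Bfin Bspan Bdual.
exists (fun f => \sum_i dual_fun f (b' i) *: a' i).
  move=> u /=; rewrite [RHS]aE.
  rewrite [X in X = _]aE; apply: eq_bigr => i _; congr (_ *: _).
  rewrite (linear_map_sum (beta_linearl (b i))) [in RHS](bE (b i)).
  rewrite (linear_map_sum (beta_linearr u)); apply: eq_bigr => j _.
  rewrite (linear_mapZ (beta_linearl (b i))) (linear_mapZ (beta_linearr u)).
  exact: mulrC.
move=> f; apply: dual_ext => v.
rewrite -[LHS]/(beta _ v) (linear_map_sum (beta_linearl v)) [in RHS](bE v).
rewrite (linear_map_sum (dual_funP f)); apply: eq_bigr => j _.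
rewrite (linear_mapZ (beta_linearl v)) (linear_mapZ (dual_funP f)).
exact: mulrC.
Qed.

End PerfectPairing.

(** * Linear forms on quotients of a path category *)

Lemma is_path_target (Q : quiver) (x y z : qvertex Q) (s : seq (qarrow Q)) :
  is_path x s y -> is_path x s z -> y = z.
Proof.
case: s => [|a s] /=; first by move=> /eqP<- /eqP.
by move=> /andP[/eqP<- _] /andP[/eqP].
Qed.

Section PathAlgebraForms.
Variables (k : fieldType) (Q : quiver).
Variable R : forall x y : path_cat k Q, khom x y -> Prop.
Implicit Types (x y z w : qvertex Q).

Definition pclass x y (p : qpath x y) : qhom R x y := qmap R << p >>.

Lemma pclassM x y z (q : qpath y z) (p : qpath x y) :
  qcomp (pclass q) (pclass p) = pclass (qpath_cat q p).
Proof. by rewrite /pclass qmapM /= kpath_compU. Qed.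

(** Used below as an induction principle on the morphisms of the quotient. *)
Lemma pclass_spanning x y : spanning (range (@pclass x y)).
Proof.
move=> S Spath u; have [u' ->] := qmap_surj u.
have SD (v v2 : qhom R x y) : S v -> S v2 -> S (v + v2).
  by move=> Sv Sw; rewrite -[v]scale1r; apply: subspaceP.
have SZ a (v : qhom R x y) : S v -> S (a *: v).
  by move=> Sv; rewrite -[_ *: _]addr0; apply: subspaceP => //; apply: subspace0.
have E p (c : k) : << c *g p >> = c *: << p >> :> {malg k[qpath x y]}.
  by apply/malgP => q; rewrite mcoeffZ !mcoeffU mulr_natr.
rewrite [u']monalgE (linear_map_sum (@qmap_linear k _ R x y)).
apply: (big_ind (fun v => S v)) => [||p _]; [exact: subspace0|exact: SD|].
by rewrite E (linear_mapZ (@qmap_linear k _ R x y)); apply: SZ; apply: Spath; exists p.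
Qed.

Lemma qhom_linear_ext x y (W : lmodType k) (f g : qhom R x y -> W) :
  linear f -> linear g -> (forall p, f (pclass p) = g (pclass p)) -> f =1 g.
Proof.
move=> f_lin g_lin fg.
have S0 : f 0 = g 0 by rewrite (linear_map0 f_lin) (linear_map0 g_lin).
have SP (c : k) u v : f u = g u -> f v = g v -> f (c *: u + v) = g (c *: u + v).
  by rewrite f_lin g_lin => -> ->.
by apply: (pclass_spanning (S := Subspace S0 SP)) => _ [p _ <-]; apply: fg.
Qed.

(** The test tau sees only the arrows of a path and not its ends, so that the
    same tau gives a form on every morphism space, and can be shifted by
    strings on both sides. *)
Definition pform (tau : seq (qarrow Q) -> bool) x y :
    khom (x : path_cat k Q) y -> k^o :=
  mlift (fun p : qpath x y => (tau (qseq p))%:R : k^o).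

Lemma pformU tau x y (p : qpath x y) : pform tau << p >> = (tau (qseq p))%:R.
Proof. exact: mliftU. Qed.

Lemma pform_linear tau x y : linear (@pform tau x y).
Proof. exact: mlift_linear. Qed.

Lemma pform_postcomp tau (x y z : path_cat k Q) (g : khom y z) (f : khom x y) :
  (forall s, pform (fun t => tau (s ++ t)) f = 0) -> pform tau (g \oc f) = 0.
Proof.
move=> tau_f; move: g; apply: (@malg_ext k (qpath y z) k^o
  (fun g : khom y z => pform tau (g \oc f)) (fun=> 0)).
- exact: (linear_comp (@pform_linear tau x z) (@kcomp_linearl k _ x y z f)).
- by move=> c u v; rewrite scaler0 addr0.
move=> q; rewrite -[RHS](tau_f (qseq q)); move: f {tau_f}.
apply: (@malg_ext k (qpath x y) k^o
  (fun f : khom x y => pform tau ((<< q >> : khom y z) \oc f))).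
- exact: (linear_comp (@pform_linear tau x z) (@kcomp_linear k _ x y z _)).
- exact: pform_linear.
by move=> p; rewrite /= kpath_compU !pformU.
Qed.

Lemma pform_precomp tau (x y z : path_cat k Q) (g : khom y z) (f : khom x y) :
  (forall s, pform (fun t => tau (t ++ s)) g = 0) -> pform tau (g \oc f) = 0.
Proof.
move=> tau_g; move: f; apply: (@malg_ext k (qpath x y) k^o
  (fun f : khom x y => pform tau (g \oc f)) (fun=> 0)).
- exact: (linear_comp (@pform_linear tau x z) (@kcomp_linear k _ x y z g)).
- by move=> c u v; rewrite scaler0 addr0.
move=> p; rewrite -[RHS](tau_g (qseq p)); move: g {tau_g}.
apply: (@malg_ext k (qpath y z) k^o
  (fun g : khom y z => pform tau (g \oc (<< p >> : khom x y)))).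
- exact: (linear_comp (@pform_linear tau x z) (@kcomp_linearl k _ x y z _)).
- exact: pform_linear.
by move=> q; rewrite /= kpath_compU !pformU.
Qed.

Variable tau : seq (qarrow Q) -> bool.
Hypothesis tau_ideal : forall (x y : path_cat k Q) (f : khom x y), R f ->
  forall a b, pform (fun s => tau (a ++ s ++ b)) f = 0.

(** An ideal is generated by two-sided multiples, and evaluating tau on the
    multiple of f by two paths amounts to evaluating on f the test shifted by
    their strings; so the induction runs over all the shifts of tau at once. *)
Lemma pform_ideal (x y : path_cat k Q) (f : khom x y) :
  ideal_gen R f -> pform tau f = 0.
Proof.
move=> If; have tauE (t : seq (qarrow Q) -> bool) :
    (t = fun s => t ([::] ++ s ++ [::])).
  by apply/funext => s; rewrite cats0.
(* tau is its own shift by empty strings. *)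
rewrite [tau]tauE; move: [::] {1}[::] => b a; elim: If a b => {x y f tauE}.
- by move=> x y f Rf a b; apply: tau_ideal.
- by move=> x y a b; apply: (linear_map0 (@pform_linear _ _ _)).
- move=> x y c f g _ IHf _ IHg a b; apply: etrans (pform_linear _ c _ _) _.
  transitivity (c *: (0 : k^o) + (0 : k^o)); last by rewrite scaler0 addr0.
  by congr (_ *: _ + _); [exact: IHf | exact: IHg].
- move=> x y z g f _ IH a b; apply: pform_postcomp => s.
  rewrite -[RHS](IH (a ++ s) b); congr (pform _ f).
  by apply/funext => t; rewrite -!catA.
- move=> x y z g f _ IH a b; apply: pform_precomp => s.
  rewrite -[RHS](IH a (s ++ b)); congr (pform _ g).
  by apply/funext => t; rewrite -!catA.
Qed.

(** By qform_qmap, every representative gives the same value. *)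
Definition qform x y (u : qhom R x y) : k^o := pform tau (repr u).

Lemma qform_qmap x y (f : khom (x : path_cat k Q) y) : qform (qmap R f) = pform tau f.
Proof.
have /pform_ideal : ideal_gen R (repr (qmap R f) - f) by apply/qmap_eq; rewrite qmap_repr.
rewrite (linear_mapB (@pform_linear _ _ _)) => /eqP.
by rewrite subr_eq0 => /eqP.
Qed.

Lemma qform_linear x y : linear (@qform x y).
Proof.
move=> c u v; have [u' ->] := qmap_surj u; have [v' ->] := qmap_surj v.
by rewrite -qmap_linear !qform_qmap pform_linear.
Qed.

Lemma qform_pclass x y (p : qpath x y) : qform (pclass p) = (tau (qseq p))%:R.
Proof. by rewrite qform_qmap pformU. Qed.

End PathAlgebraForms.

(** * Arrow strings of standard sequences *)

Section StandardStrings.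
Variable E : fbc.
Implicit Types (e f h : E) (a b s : seq (fbc_arrow E)).

(** The path L(g^(n-1) e) ... L(g e) L(e), for any n: the sequence (e, n) need
    not be standard. *)
Definition arrows e n : seq (fbc_arrow E) :=
  [seq arrow_of (gact i%:Z e) | i <- rev (iota 0 n)].

Lemma fd_gact m e : fd (gact m e) = fd e.
Proof. by apply/esym/fbc3; exists m. Qed.

Lemma arrow_of_eq e h : arrow_of e = arrow_of h <-> fL e = fL h.
Proof. by split=> [/(congr1 val)|eh] //; apply: val_inj. Qed.

Lemma fP_eq e h : fP e = fP h -> fP e h.
Proof. by move->; apply: (fP_partition E).1. Qed.

Lemma vertex_of_eq e h : vertex_of e = vertex_of h <-> fP e = fP h.
Proof. by split=> [/(congr1 val)|eh] //; apply: val_inj. Qed.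

Lemma size_arrows e n : size (arrows e n) = n.
Proof. by rewrite size_map size_rev size_iota. Qed.

Lemma arrowsS e n : arrows e n.+1 = arrow_of (gact n%:Z e) :: arrows e n.
Proof. by rewrite /arrows -addn1 iotaD rev_cat. Qed.

Lemma arrows_cat e n m : arrows e (n + m) = arrows (gact n%:Z e) m ++ arrows e n.
Proof.
elim: m => [|m IHm]; first by rewrite addn0.
by rewrite addnS !arrowsS IHm -gactD -PoszD addnC.
Qed.

Lemma arrows_eq e h n m : arrows e n = arrows h m <->
  n = m /\ forall i : nat, (i < n)%N -> fL (gact i%:Z e) = fL (gact i%:Z h).
Proof.
split=> [eh|[<- {m}]].
  have nm : n = m by rewrite -(size_arrows e n) eh size_arrows.
  split=> // i; rewrite -{m}nm in eh; elim: n eh => // n IHn.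
  move/eqP; rewrite !arrowsS eqseq_cons => /andP[/eqP/arrow_of_eq eh /eqP/IHn IH].
  by rewrite ltnS leq_eqVlt => /orP[/eqP->|/IH].
elim: n => // n IHn eh; rewrite !arrowsS IHn => [|i i_n]; last exact/eh/ltnW.
by congr (_ :: _); apply/arrow_of_eq/eh.
Qed.

Lemma cat_arrows a b e n : a ++ b = arrows e n ->
  a = arrows (gact (size b)%:Z e) (size a) /\ b = arrows e (size b).
Proof.
move=> ab; have nE : n = (size b + size a)%N.
  by rewrite -(size_arrows e n) -ab size_cat addnC.
move/eqP: ab; rewrite nE arrows_cat eqseq_cat ?size_arrows // => /andP[/eqP aE /eqP bE].
by [].
Qed.

Lemma class_seqE e n : class_seq (@gact E) (@fL E) e n = map val (arrows e n).
Proof. by rewrite /class_seq /arrows -map_comp. Qed.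

Lemma path_classesE x y (p : @qpath (fbc_quiver E) x y) e n :
  path_classes p = class_seq (@gact E) (@fL E) e n <-> qseq p = arrows e n.
Proof.
by rewrite class_seqE; split=> [/(inj_map val_inj)|] //; rewrite /path_classes => ->.
Qed.

Lemma is_path_arrows e n :
  @is_path (fbc_quiver E) (vertex_of e) (arrows e n) (vertex_of (gact n%:Z e)).
Proof.
elim: n => [|n IHn]; first by rewrite gact0 /=.
rewrite arrowsS /=; apply/andP; split.
  by apply/eqP; rewrite fbc_target_of -gactD -intS.
by rewrite fbc_source_of.
Qed.

Lemma is_path_arrows_target e n x y : x = vertex_of e ->
  @is_path (fbc_quiver E) x (arrows e n) y -> y = vertex_of (gact n%:Z e).
Proof. by move-> => /is_path_target; apply; apply: is_path_arrows. Qed.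

Lemma is_path_arrows_source e n x y : (0 < n)%N ->
  @is_path (fbc_quiver E) x (arrows e n) y -> x = vertex_of e.
Proof.
case: n => // n _; elim: n y => [|n IHn] y; rewrite arrowsS /= => /andP[_].
  by move=> /eqP->; rewrite gact0; apply: fbc_source_of.
exact: IHn.
Qed.

(** Condition fbc6, index by index: the formal sequence of e would otherwise
    occur properly at position j inside that of h. *)
Lemma full_antichain e h (j : nat) : (j + fd e <= fd h)%N ->
  (forall i : nat, (i < fd e)%N ->
    fL (gact i%:Z e) = fL (gact (j + i)%N%:Z h)) ->
  j = 0 /\ fd e = fd h.
Proof.
move=> le eh; have aE : arrows e (fd e) = arrows (gact j%:Z h) (fd e).
  by apply/arrows_eq; split=> // i /eh ->; rewrite -gactD addrC.
have /= := fbc6 e h; rewrite !class_seqE.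
have hE : fd h = (j + fd e + (fd h - (j + fd e)))%N by rewrite subnKC.
have -> /= : infix (map val (arrows e (fd e))) (map val (arrows h (fd h))).
  rewrite hE !arrows_cat -aE !map_cat; apply/infixP.
  by exists (map val (arrows (gact (j + fd e)%N%:Z h) (fd h - (j + fd e)))),
    (map val (arrows h j)).
rewrite negbK => /eqP /(inj_map val_inj) /(congr1 size); rewrite !size_arrows.
by move: (fd e) (fd h) le => n m; lia.
Qed.

(** * Complements and the exchange property of full strings *)

Lemma nakayama_gact m e : nakayama (gact m e) = gact m (nakayama e).
Proof. by rewrite /nakayama fd_gact -!gactD addrC. Qed.

Lemma nakayama_L e h : fL (nakayama e) = fL (nakayama h) <-> fL e = fL h.
Proof. by split=> /(fbc5 e h). Qed.

Lemma nakayama_P e h : fP (nakayama e) = fP (nakayama h) <-> fP e = fP h.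
Proof. by split=> /(fbc4 e h). Qed.

(** For a nonempty sequence the vertex is determined by the first arrow, so one
    criterion covers trivial and nontrivial sequences alike. *)
Lemma formal_eq (p q : preseq E) : formal p = formal q <->
  [/\ p.2 = q.2, fP p.1 = fP q.1
    & forall i : nat, (i < p.2)%N -> fL (gact i%:Z p.1) = fL (gact i%:Z q.1)].
Proof.
case: p q => [e n] [h m]; rewrite /formal /= !class_seqE; split; last first.
  case=> <- eh ehL; rewrite eh; case: ifP => // _.
  by congr (inr (map _ _)); apply/arrows_eq.
case: n m => [|n] [|m] //= eq_eh; first by case: eq_eh.
have /arrows_eq[nm ehL] : arrows e n.+1 = arrows h m.+1.
  apply: (inj_map val_inj).
  exact: (congr1 (fun s : set E + seq (set E) => if s is inr t then t else [::]) eq_eh).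
by split=> //; apply: fP_of_fL; rewrite -[e]gact0 -[h]gact0; apply: ehL.
Qed.

(** The automorphism sigma on sequences. By fbc4 and fbc5 it preserves and
    reflects the relation of having the same formal sequence, and it turns
    right complements into left complements. *)
Definition nakayama_pre (p : preseq E) : preseq E := (nakayama p.1, p.2).

Lemma formal_nakayama p q :
  formal (nakayama_pre p) = formal (nakayama_pre q) <-> formal p = formal q.
Proof.
split=> /formal_eq[/= pq PE LE]; apply/formal_eq; split=> //=.
- exact/nakayama_P.
- by move=> i /LE; rewrite -!nakayama_gact => /nakayama_L.
- exact/nakayama_P.
- by move=> i /LE; rewrite -!nakayama_gact => /nakayama_L.
Qed.

Lemma nakayama_pre_rcompl p : nakayama_pre (rcompl p) = lcompl p.
Proof.
case: p => e n; rewrite /nakayama_pre /rcompl /lcompl /nakayama /=.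
by rewrite fd_gact -gactD addrC subrK.
Qed.

Lemma rcompl_nakayama_pre p : rcompl (nakayama_pre p) = lcompl p.
Proof.
by rewrite /rcompl /lcompl /nakayama_pre /nakayama /= !fd_gact -gactD subrK.
Qed.

Lemma standard_nakayama p : standard (nakayama_pre p) <-> standard p.
Proof. by rewrite /standard /= fd_gact. Qed.

Lemma nakayama_pre_surj q : exists p, q = nakayama_pre p.
Proof.
case: q => e n; exists (gact (- (fd e)%:Z) e, n).
by rewrite /nakayama_pre /nakayama fd_gact /= -gactD subrr gact0.
Qed.

(** Taking both complements, in either order, gives the same set: the sequences
    equivalent to the right complement of p are moved by sigma onto those
    equivalent to its left complement, and the left complement of r is the
    right complement of sigma(r). So the two alternatives of type_S are one
    condition. *)
Lemma two_sided_complement p :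
  std_closure (@lcompl E @` std_closure [set rcompl p]) =
  std_closure (@rcompl E @` std_closure [set lcompl p]).
Proof.
congr std_closure; apply/seteqP; split=> _ [r [rS [_ -> req]] <-].
  exists (nakayama_pre r); last exact: rcompl_nakayama_pre.
  split; first exact/standard_nakayama.
  by exists (lcompl p) => //; rewrite -nakayama_pre_rcompl; apply/formal_nakayama.
have [s rs] := nakayama_pre_surj r; rewrite rs in rS req *.
exists s; last by rewrite rcompl_nakayama_pre.
split; first exact/standard_nakayama.
exists (rcompl p) => //; apply/formal_nakayama.
by rewrite nakayama_pre_rcompl.
Qed.

(** The side condition of fbc_rel1: the initial parts of length d(e) - m and
    d(h) - m of the full sequences of e and h have left complements with the
    same formal sequence. *)
Definition same_complement e h (m : nat) : Prop :=
  [/\ (m <= minn (fd e) (fd h))%N, fP e = fP h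
    & forall i : nat, (1 <= i <= m)%N ->
      fL (gact ((fd e)%:Z - i%:Z) e) = fL (gact ((fd h)%:Z - i%:Z) h)].

Definition full_string s : Prop := exists e, s = arrows e (fd e).

Lemma same_complement_sym e h m : same_complement e h m -> same_complement h e m.
Proof. by case=> le PE LE; split; rewrite 1?minnC // => i /LE ->. Qed.

(** A trivial initial part only matches a trivial one: the full sequence of e
    would otherwise be a proper final part of that of h, against fbc6. *)
Lemma same_complement_full e h m : same_complement e h m -> m = fd e -> fd h = m.
Proof.
case=> le PE LE mE.
have [] := @full_antichain e h (fd h - fd e); last by move=> _ <-.
  by move: le; rewrite leq_min => /andP[]; lia.
move=> i i_e; move: le; rewrite leq_min => /andP[le1 le2].
have /LE : (0 < fd e - i <= m)%N by rewrite mE; lia.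
have -> : (fd e)%:Z - (fd e - i)%N%:Z = i%:Z by lia.
have -> // : (fd h)%:Z - (fd e - i)%N%:Z = (fd h - fd e + i)%N%:Z by lia.
Qed.

Hypothesis E_typeS : type_S E.

(** Let p and q be the initial parts of the full sequences of e and h, and p'
    the occurrence of the string of p inside the full sequence of f. Then q has
    the same left complement as p, so it belongs to the two-sided complement set
    of p, and by type_S to that of p'. Thus q has the string of the right
    complement of some w equivalent to the left complement of p'. The left
    complement of p' follows a and then sigma(b); so does w, and fbc5 pulls
    sigma(b) back to b. So the full sequence in the orbit of w whose last terms
    are those of w along a starts with b, and its string is a, q, b. *)
Lemma full_exchange e h m a b : same_complement e h m ->
  full_string (a ++ arrows e (fd e - m) ++ b) ->
  full_string (a ++ arrows h (fd h - m) ++ b).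
Proof.
(* A trivial p has no arrow to show that it starts where b ends. *)
move=> ehm [f fE]; have [me|m_ne] := eqVneq m (fd e).
  by exists f; rewrite -fE (same_complement_full ehm me) -me !subnn.
case: (ehm) => le PE LE; move: (le); rewrite leq_min => /andP[le_e le_h].
have szE : (size a + (fd e - m) + size b = fd f)%N.
  by rewrite -(size_arrows f (fd f)) -fE !size_cat size_arrows addnA.
have [aE] := cat_arrows fE; rewrite size_cat !size_arrows => efE.
have [eE bE] := cat_arrows efE; rewrite size_arrows in eE.
rewrite size_cat size_arrows in aE.
set n := (fd e - m)%N in szE aE eE efE *.
set nb := size b in szE aE bE eE efE *.
set na := size a in szE aE bE eE efE *.
pose p : preseq E := (e, n); pose p' : preseq E := (gact nb f, n).
pose q : preseq E := (h, (fd h - m)%N).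
have pS : standard p by rewrite /standard /p /n /=; lia.
have pS' : standard p' by rewrite /standard /p' /= fd_gact; lia.
have /arrows_eq[_ efL] := eE.
have pp' : formal p = formal p'.
  apply/formal_eq; split=> //=; apply: fP_of_fL.
  by have := efL 0; rewrite !gact0; apply; lia.
(* q is the right complement of its own left complement, equivalent to that of p. *)
have q_p : std_closure (@rcompl E @` std_closure [set lcompl p]) q.
  split; first by rewrite /standard /q /=; lia.
  exists q => //; exists (lcompl q); last first.
    rewrite /rcompl /lcompl /q /= fd_gact -gactD.
    have -> : (fd h - (fd h - m) = m)%N by lia.
    have -> : m%:Z - (fd h)%:Z + (fd h - m)%N%:Z = 0 by lia.
    by rewrite gact0.
  split; first by rewrite /standard /lcompl /q /= fd_gact; lia.
  exists (lcompl p) => //; apply/formal_eq; rewrite /lcompl /q /p /n /=.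
  split; first by lia.
    have [m0|m_gt0] := posnP m.
      rewrite m0 !subn0 -!/(nakayama _); apply/nakayama_P/esym/PE.
    have := LE m; rewrite leqnn m_gt0 => /(_ isT).
    have -> : (fd e)%:Z - m%:Z = (fd e - m)%N%:Z by lia.
    have -> : (fd h)%:Z - m%:Z = (fd h - m)%N%:Z by lia.
    by move=> /fP_of_fL.
  move=> i i_m; rewrite -!gactD.
  have i_m' : (0 < m - i <= m)%N by lia.
  have := LE _ i_m'.
  have -> : (fd e)%:Z - (m - i)%N%:Z = i%:Z + (fd e - m)%N%:Z by lia.
  by have -> : (fd h)%:Z - (m - i)%N%:Z = i%:Z + (fd h - m)%N%:Z by lia.
have {q_p} : std_closure (@rcompl E @` std_closure [set lcompl p']) q.
  have [<-//|] := E_typeS pS pS' pp'.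
  by rewrite !two_sided_complement => <-.
case=> _ [_ [[w l] [wS [_ -> /formal_eq/=[lE wP wL]]] <-] /formal_eq/=[]].
rewrite fd_gact in lE; rewrite /standard /= in wS => dwE _ hL.
(* The right complement of (w, l) starts at g^(l - d(w)) w; the copy of b comes
   before it. *)
pose f' : E := gact (l%:Z - (fd w)%:Z - nb%:Z) w.
have df' : fd f' = fd w by apply: fd_gact.
have wf' : w = gact (fd w - na)%N%:Z f'.
  by rewrite /f' -gactD -[LHS]gact0; congr gact; lia.
exists f'; rewrite df'.
have -> : fd w = (nb + (fd w - l) + na)%N by lia.
rewrite !arrows_cat; congr (_ ++ (_ ++ _)).
- rewrite aE; apply/arrows_eq; split=> // i i_na.
  have := wL i; rewrite {1}wf' -!gactD => wLi; have {}wLi := wLi ltac:(lia).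
  have -> : i%:Z + (nb + (fd w - l))%N%:Z = i%:Z + (fd w - na)%N%:Z by lia.
  rewrite wLi; congr (fL (gact _ _)); lia.
- apply/arrows_eq; split; first by lia.
  move=> i i_h; rewrite hL; last by lia.
  congr (fL (gact _ _)); rewrite /f' -gactD; congr gact; lia.
- rewrite bE; apply/arrows_eq; split=> // i i_nb; apply/nakayama_L.
  have := wL (na + i)%N; rewrite {1}wf' -!gactD.
  move=> wLi; have {}wLi := wLi ltac:(lia).
  rewrite /nakayama !fd_gact -!gactD.
  have -> : (fd f)%:Z + i%:Z = (na + i)%N%:Z + n%:Z + nb%:Z by lia.
  rewrite -wLi; congr (fL (gact _ _)); lia.
Qed.

End StandardStrings.

(** * Standard paths span the morphism spaces *)

Section FbcCategoryStructure.
Variables (k : fieldType) (E : fbc).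
Implicit Types (e f h : E) (x y z : fbc_vertex E) (s a b : seq (fbc_arrow E)).

Notation Q := (fbc_quiver E).
Notation R := (@fbc_rel k E).

Definition standard_string s : Prop :=
  exists e, (size s <= fd e)%N /\ s = arrows e (size s).

Lemma nth_arrows (a0 : fbc_arrow E) e n j : (j < n)%N ->
  nth a0 (arrows e n) j = arrow_of (gact (n - j.+1)%N%:Z e).
Proof.
elim: n j => // n IHn [|j]; rewrite arrowsS ?subn1 //= ltnS => /IHn ->.
by rewrite subSS.
Qed.

(** Hence the trace is zero on every multiple of a nonstandard string. *)
Lemma standard_of_infix_full a s b : full_string (a ++ s ++ b) -> standard_string s.
Proof.
case=> f fE; have szE := congr1 size fE.
rewrite !size_cat size_arrows in szE.
have [_ /cat_arrows[sE _]] := cat_arrows fE.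
by exists (gact (size b)%:Z f); split=> //; rewrite fd_gact -szE; lia.
Qed.

(** Otherwise fbc6 would fail for the full sequence of e, a proper part of the
    full sequence of another element. *)
Lemma overlong_not_standard e n : (fd e < n)%N -> ~ standard_string (arrows e n).
Proof.
rewrite /standard_string size_arrows => lt_n [f [le_n /arrows_eq[_ ef]]].
have [] := @full_antichain _ e f 0; first by lia.
  by move=> i i_e; apply: ef; lia.
by lia.
Qed.

Lemma cyclic_intersection_arrows e n :
  \bigcap_(j in [set j | (j < n)%N])
    (gact j%:Z @` nth set0 (map val (arrows e n)) j) !=set0.
Proof.
exists (gact n.-1%:Z e) => j /= jn; exists (gact (n - j.+1)%N%:Z e); last first.
  by rewrite -gactD; congr gact; lia.
rewrite (nth_map (arrow_of e)) ?size_arrows // nth_arrows //=.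
exact: (fL_partition E).1.
Qed.

(** An element u of the intersection in fbc_rel2 is the last term of an orbit
    segment that runs through the classes of s; its first term is e. *)
Lemma cyclic_intersection_standard s :
  \bigcap_(j in [set j | (j < size s)%N])
    (gact j%:Z @` nth set0 (map val s) j) !=set0 ->
  exists e, s = arrows e (size s).
Proof.
case=> u us; exists (gact (- (size s).-1%:Z) u).
apply: (@eq_from_nth _ (arrow_of u)); first by rewrite size_arrows.
move=> j js; have [v] := us j js; rewrite (nth_map (arrow_of u)) //.
have [w ->] := arrow_ofP (nth (arrow_of u) s j) => /= wv vu.
rewrite nth_arrows // -gactD.
have -> : (size s - j.+1)%N%:Z - (size s).-1%:Z = - j%:Z.
  move: (size s) js => n; lia.
rewrite -vu -gactD addNr gact0; apply/arrow_of_eq.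
by apply/esym; apply: (fL_partition E).2.
Qed.

Section Forms.
Variable tau : seq (fbc_arrow E) -> bool.
Hypothesis tau_exchange : forall e h m a b, same_complement e h m ->
  tau (a ++ arrows e (fd e - m) ++ b) = tau (a ++ arrows h (fd h - m) ++ b).
Hypothesis tau_standard : forall a s b,
  (0 < size s)%N -> ~ standard_string s -> tau (a ++ s ++ b) = false.

(** The exchange hypothesis is for fbc_rel1; the other one is for fbc_rel2 and
    fbc_rel3, whose strings are not standard. *)
Lemma pform_fbc_rel (x y : path_cat k Q) (f : khom x y) : fbc_rel f ->
  forall a b, @pform k Q (fun s => tau (a ++ s ++ b)) _ _ f = 0.
Proof.
case.
- case=> e [h [m [p [q [le [xe xh] LE [/path_classesE pE /path_classesE qE] ->]]]]] a b.
  apply: etrans (linear_mapB (@pform_linear _ _ _ _ _) _ _) _.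
  rewrite !pformU pE qE (@tau_exchange e h) ?subrr //; split=> //.
  by apply/vertex_of_eq; rewrite -xe.
- case=> p [p_gt1 p0 ->] a b; rewrite pformU tau_standard //; first exact: ltnW.
  move=> [e [_ pE]]; move: p0; rewrite /path_classes pE => /eqP.
  by rewrite size_arrows => /eqP; apply/eqP/set0P/cyclic_intersection_arrows.
- case=> e [n [p [lt_n /path_classesE pE ->]]] a b.
  rewrite pformU pE tau_standard //; last exact: overlong_not_standard.
  by rewrite size_arrows; lia.
Qed.

End Forms.

Definition standard_path x y (p : @qpath Q x y) : Prop :=
  exists e, [/\ x = vertex_of e, (size p <= fd e)%N & qseq p = arrows e (size p)].

Lemma standard_or_zero x y (p : @qpath Q x y) : standard_path p \/ pclass R p = 0.
Proof.
have zeroP : ideal_gen R (<< p >> : khom (x : path_cat k Q) y) -> pclass R p = 0.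
  move=> Ip; transitivity (qmap R (0 : khom (x : path_cat k Q) y)).
    by apply/qmap_eq; rewrite subr0.
  exact: (linear_map0 (@qmap_linear _ _ _ _ _)).
have [p0|p_gt0] := posnP (size p).
  left; have [e xe] := vertex_ofP x; exists e; split=> //; rewrite p0 //.
  exact: size0nil.
suff claim : (exists e, qseq p = arrows e (size p)) \/ pclass R p = 0.
  have [[e pE]|->] := claim; last by right.
  have [e_p|p_e] := leqP (size p) (fd e); last first.
    right; apply/zeroP/Ideal_gen/Or33; exists e, (size p), p; split=> //.
    exact/path_classesE.
  left; exists e; split=> //; apply: (is_path_arrows_source p_gt0 (y := y)).
  by rewrite -pE; apply: qpathP.
have [p_gt1|p_le1] := ltnP 1 (size p); last first.
  left; move: p_gt0 p_le1; case: (qseq p) => [|a [|? ?]] //= _ _.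
  have [e ->] := arrow_ofP a; exists e.
  by rewrite arrowsS gact0.
have [[u Iu]|I0] := pselect (\bigcap_(j in [set j | (j < size p)%N])
    (gact j%:Z @` nth set0 (path_classes p) j) !=set0).
  by left; apply: cyclic_intersection_standard; exists u.
right; apply/zeroP/Ideal_gen/Or32; exists p; split=> //.
by apply/eqP; apply: contrapT => /negP /set0P.
Qed.

Lemma same_complement_pclass e h m x y (p q : @qpath Q x y) :
  same_complement e h m -> x = vertex_of e ->
  qseq p = arrows e (fd e - m) -> qseq q = arrows h (fd h - m) ->
  pclass R p = pclass R q.
Proof.
case=> le PE LE xe pE qE; apply/qmap_eq/Ideal_gen/Or31.
exists e, h, m, p, q; split=> //; last by split; apply/path_classesE.
by split=> //; rewrite xe; apply/vertex_of_eq.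
Qed.

Definition standard_classes x y : set (qhom R x y) :=
  [set u | exists2 p : @qpath Q x y, standard_path p & u = pclass R p].

Lemma standard_classes_spanning x y : spanning (@standard_classes x y).
Proof.
move=> S SA; apply: pclass_spanning => _ [p _ <-].
have [pS|->] := standard_or_zero p; last exact: subspace0.
by apply: SA; exists p.
Qed.

End FbcCategoryStructure.

(** * The augmentation and the trace *)

Section TraceAndAugmentation.
Variables (k : fieldType) (E : fbc).
Implicit Types (e f h : E) (x y z : fbc_vertex E) (s a b : seq (fbc_arrow E)).

Notation Q := (fbc_quiver E).
Notation R := (@fbc_rel k E).
Notation sigma x := (@nakayama_obj k E x).

Lemma nakayama_objE e :
  nakayama_obj (vertex_of e : fbc_cat k E) = vertex_of (nakayama e).
Proof. exact: nakayama_obj_of. Qed.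

(** On the endomorphisms of x, this is the projection onto k along the radical. *)
Definition augmentation x y (u : qhom R x y) : k^o :=
  @qform k Q R (fun s => s == [::]) x y u.

Lemma augmentation_ideal (x y : path_cat k Q) (f : khom x y) : fbc_rel f ->
  forall a b, @pform k Q (fun s => a ++ s ++ b == [::]) _ _ f = 0.
Proof.
apply: (@pform_fbc_rel k E (fun s => s == [::])) => [e h m a b ehm|a s b s_gt0 _].
  have emp s : (s == [::]) = (size s == 0%N) by rewrite -size_eq0.
  rewrite !emp !size_cat !size_arrows; case: (ehm) => le _ _.
  have := same_complement_full ehm; have := same_complement_full (same_complement_sym ehm).
  by move: le; lia.
by case: a s s_gt0 => [|? ?] [].
Qed.

Lemma augmentation_linear x y : linear (@augmentation x y).
Proof. exact (@qform_linear k Q R _ augmentation_ideal x y). Qed.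

Lemma augmentation_pclass x y (p : @qpath Q x y) :
  augmentation (pclass R p) = (qseq p == [::])%:R.
Proof. exact (@qform_pclass k Q R _ augmentation_ideal x y p). Qed.

Hypothesis E_typeS : type_S E.

(** The test is false on the strings that do not lead from x to sigma(x), so the
    trace may be defined on all morphism spaces. *)
Definition trace x y (u : qhom R x y) : k^o :=
  @qform k Q R (fun s => `[< full_string s >]) x y u.

Lemma trace_ideal (x y : path_cat k Q) (f : khom x y) : fbc_rel f ->
  forall a b, @pform k Q (fun s => `[< full_string (a ++ s ++ b) >]) _ _ f = 0.
Proof.
apply: (@pform_fbc_rel k E (fun s => `[< full_string s >])) => [e h m a b ehm|a s b _ sN].
  apply/asboolP/asboolP; first exact: full_exchange.
  by apply: full_exchange => //; apply: same_complement_sym.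
by apply/asboolP => /standard_of_infix_full.
Qed.

Lemma trace_linear x y : linear (@trace x y).
Proof. exact (@qform_linear k Q R _ trace_ideal x y). Qed.

Lemma trace_pclass x y (p : @qpath Q x y) :
  trace (pclass R p) = `[< full_string p >]%:R.
Proof. exact (@qform_pclass k Q R _ trace_ideal x y p). Qed.

Definition pairing x y z (v : qhom R y z) (u : qhom R x y) : k^o :=
  trace (qcomp v u).

Lemma pairing_pclass x y z (q : @qpath Q y z) (p : @qpath Q x y) :
  pairing (pclass R q) (pclass R p) = `[< full_string (q ++ p) >]%:R.
Proof. by rewrite /pairing pclassM trace_pclass. Qed.

(** The vector dual to p is its left complement q: if q p' is the full string of
    f, then q is also the left complement of p' in f, and fbc_rel1 identifies p'
    with p. *)
Lemma standard_classes_left_dual x y :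
  has_dual_vectors (fun u v => @pairing x y (sigma x) v u)
    (@standard_classes k E x y).
Proof.
move=> _ [p [e [xe le_p pE]] ->].
set n := size p in le_p pE.
have ye : y = vertex_of (gact n%:Z e).
  by apply: (is_path_arrows_target xe); rewrite -pE; apply: qpathP.
have qP : @is_path Q y (arrows (gact n%:Z e) (fd e - n)) (sigma x).
  rewrite xe nakayama_objE ye.
  have -> : nakayama e = gact (fd e - n)%N%:Z (gact n%:Z e).
    by rewrite -gactD; congr gact; lia.
  exact: is_path_arrows.
exists (pclass R (QPath qP)) => _ [p' _ ->].
have [->|p'_p] := eqVneq.
  by rewrite pairing_pclass /= pE -arrows_cat subnKC // asboolT //; exists e.
rewrite pairing_pclass /=; case: asboolP => // -[f fE]; case/eqP: p'_p.
pose l : nat := size p'.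
have szE : (fd e - n + l)%N = fd f.
  by have := congr1 size fE; rewrite size_cat !size_arrows.
have [qE p'E] : arrows (gact n%:Z e) (fd e - n) = arrows (gact l%:Z f) (fd e - n) /\
    qseq p' = arrows f l.
  by have := cat_arrows fE; rewrite size_arrows.
have xf : x = vertex_of f.
  apply: (@is_path_arrows_source E f (fd f) x (sigma x)); first exact: fd_gt0.
  by rewrite -fE; apply: is_path_cat qP (qpathP p').
apply: (@same_complement_pclass k E f e (fd e - n)) => //.
- split.
  + by rewrite leq_min; lia.
  + by apply/vertex_of_eq; rewrite -xe -xf.
  + move=> i i_n; have /arrows_eq[_ qL] := qE.
    have := qL (fd e - n - i)%N; rewrite -!gactD => /(_ ltac:(lia)).
    have -> : (fd e - n - i)%N%:Z + n%:Z = (fd e)%:Z - i%:Z by lia.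
    have -> // : (fd e - n - i)%N%:Z + l%:Z = (fd f)%:Z - i%:Z by lia.
- by rewrite p'E; congr arrows; lia.
- by rewrite pE; congr arrows; lia.
Qed.

(** The vector dual to q is its right complement p: if q' p is the full string
    of f, then the left complements of q' and of q read sigma(p) in both
    sequences by fbc5, and fbc_rel1 identifies q' with q. *)
Lemma standard_classes_right_dual x y :
  has_dual_vectors (@pairing x y (sigma x))
    (@standard_classes k E y (sigma x)).
Proof.
move=> _ [q [e [ye le_q qE]] ->].
set n := size q in le_q qE.
have xe : x = vertex_of (gact (n%:Z - (fd e)%:Z) e).
  have [h xh] := vertex_ofP x; rewrite xh; apply/vertex_of_eq/nakayama_P.
  have : vertex_of (nakayama h) = vertex_of (gact n%:Z e).
    rewrite -nakayama_objE -xh; apply: (is_path_arrows_target ye).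
    by rewrite -qE; apply: qpathP.
  move/vertex_of_eq ->; congr fP; rewrite /nakayama fd_gact -gactD.
  by congr gact; lia.
have pP : @is_path Q x (arrows (gact (n%:Z - (fd e)%:Z) e) (fd e - n)) y.
  rewrite xe ye.
  have := is_path_arrows (gact (n%:Z - (fd e)%:Z) e) (fd e - n); rewrite -gactD.
  have -> : (fd e - n)%N%:Z + (n%:Z - (fd e)%:Z) = 0 by lia.
  by rewrite gact0.
exists (pclass R (QPath pP)) => _ [q' _ ->].
have [->|q'_q] := eqVneq.
  rewrite pairing_pclass /= qE.
  rewrite asboolT //.
  exists (gact (n%:Z - (fd e)%:Z) e); rewrite fd_gact.
  rewrite -[in X in _ = arrows _ X](subnK le_q) arrows_cat -gactD.
  have -> : (fd e - n)%N%:Z + (n%:Z - (fd e)%:Z) = 0 by lia.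
  by rewrite gact0.
rewrite pairing_pclass /=; case: asboolP => // -[f fE]; case/eqP: q'_q.
pose l : nat := size q'.
have szE : (l + (fd e - n))%N = fd f.
  by have := congr1 size fE; rewrite size_cat !size_arrows.
have [q'E pE] : qseq q' = arrows (gact (fd e - n)%N%:Z f) l /\
    arrows (gact (n%:Z - (fd e)%:Z) e) (fd e - n) = arrows f (fd e - n).
  by have := cat_arrows fE; rewrite !size_arrows.
have xf : x = vertex_of f.
  apply: (@is_path_arrows_source E f (fd f) x (sigma x)); first exact: fd_gt0.
  by rewrite -fE; apply: is_path_cat (qpathP q') pP.
have yf : y = vertex_of (gact (fd e - n)%N%:Z f).
  by apply: (is_path_arrows_target xf); rewrite -pE.
apply: (@same_complement_pclass k E (gact (fd e - n)%N%:Z f) e (fd e - n)) => //.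
- split.
  + by rewrite leq_min fd_gact; lia.
  + by apply/vertex_of_eq; rewrite -yf.
  + move=> i i_n; have /arrows_eq[_ pL] := pE.
    have /pL/nakayama_L : (fd e - n - i < fd e - n)%N by lia.
    rewrite /nakayama !fd_gact -!gactD => pLi; apply/esym.
    have -> : (fd e)%:Z - i%:Z =
        (fd e)%:Z + (fd e - n - i)%N%:Z + (n%:Z - (fd e)%:Z) by lia.
    by rewrite pLi; congr (fL (gact _ _)); lia.
- by rewrite fd_gact q'E; congr arrows; lia.
- by rewrite qE; congr arrows; lia.
Qed.

End TraceAndAugmentation.

(** * Finiteness *)

Section Finiteness.
Variables (k : fieldType) (E : fbc).
Implicit Types (e f h : E) (x y z : fbc_vertex E) (s a b : seq (fbc_arrow E)).

Notation Q := (fbc_quiver E).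
Notation R := (@fbc_rel k E).

Definition standard_starts e0 : set (preseq E) :=
  [set p | fP e0 p.1 /\ standard p].

Lemma standard_starts_finite e0 : finite_set (standard_starts e0).
Proof.
apply: (@sub_finite_set _ _
  (\bigcup_(e in fP e0) ((fun n => (e, n)) @` [set n | (n < (fd e).+1)%N]))).
  by move=> [e n] [/= e0e en]; exists e => //; exists n.
apply: bigcup_finite; first exact: (fbc1 e0).2.
by move=> e _; apply: finite_image; apply: finite_II.
Qed.

Lemma standard_classes_finite x y : finite_set (@standard_classes k E x y).
Proof.
have [e0 ->] := vertex_ofP x; set x0 := vertex_of e0.
pose g (p : preseq E) : qhom R x0 y :=
  if @insub (seq (qarrow Q)) _ (@qpath Q x0 y) (arrows p.1 p.2) is Some q
  then pclass R q else 0.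
apply: (@sub_finite_set _ _ (g @` standard_starts e0)); last first.
  exact/finite_image/standard_starts_finite.
move=> _ [p [e [xe le_p pE]] ->]; exists (e, size p).
  by split=> //=; apply/fP_eq/vertex_of_eq.
by rewrite /g /= -pE valK.
Qed.

Lemma standard_targets_finite x :
  finite_set [set y | @standard_classes k E x y !=set0].
Proof.
have [e0 ->] := vertex_ofP x.
apply: (@sub_finite_set _ _
  ((fun p : preseq E => vertex_of (gact p.2%:Z p.1)) @` standard_starts e0)).
  move=> y [_ [p [e [xe le_p pE]] _]]; exists (e, size p).
    by split=> //=; apply/fP_eq/vertex_of_eq.
  apply/esym/(is_path_arrows_target xe); rewrite /= -pE; exact: qpathP.
exact/finite_image/standard_starts_finite.
Qed.

Lemma standard_sources_finite x :
  finite_set [set y | @standard_classes k E y x !=set0].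
Proof.
have [e0 ->] := vertex_ofP x.
apply: (@sub_finite_set _ _
  ((fun p : preseq E => vertex_of (gact (- p.2%:Z) p.1)) @` standard_starts e0)).
  move=> y [_ [p [e [ye le_p pE]] _]]; exists (gact (size p)%:Z e, size p).
    split=> /=; last by rewrite /standard /= fd_gact.
    by apply/fP_eq/vertex_of_eq/(is_path_arrows_target ye); rewrite -pE; apply: qpathP.
  by rewrite /= -gactD addNr gact0.
exact/finite_image/standard_starts_finite.
Qed.

Lemma long_paths_vanish x : exists D, forall y (p : @qpath Q x y),
  (D <= size p)%N -> pclass R p = 0.
Proof.
have [e0 ->] := vertex_ofP x.
have /finite_seqP[s sE] : finite_set (@fd E @` fP e0).
  by apply: finite_image; apply: (fbc1 e0).2.
exists (\max_(n <- s) n).+1 => y p long; have [[e [xe le_p _]]|//] := standard_or_zero k p.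
have es : fd e \in s.
  have : (@fd E @` fP e0) (fd e) by exists e => //; apply/fP_eq/vertex_of_eq.
  by rewrite sE.
have fe : (fd e <= \max_(n <- s) n)%N by apply: leq_bigmax_seq.
by move: (leq_trans long (leq_trans le_p fe)); rewrite ltnn.
Qed.

End Finiteness.

(** * Endomorphism rings are local *)

Section LocalEndomorphisms.
Variables (k : fieldType) (E : fbc).
Implicit Types (x y z : fbc_vertex E).

Notation Q := (fbc_quiver E).
Notation R := (@fbc_rel k E).
Notation C := (fbc_cat k E).

Lemma augmentationM x y z (v : qhom R y z) (u : qhom R x y) :
  augmentation (qcomp v u) = augmentation v * augmentation u.
Proof.
have compl (w : qhom R y z) : linear (fun t : qhom R x y => qcomp w t).
  exact: (@kcomp_linear k C x y z w).
have compr (w : qhom R x y) : linear (fun t : qhom R y z => qcomp t w).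
  exact: (@kcomp_linearl k C x y z w).
move: v; apply: qhom_linear_ext => [||q].
- exact: (linear_comp (@augmentation_linear k E x z) (compr u)).
- move=> c v1 v2; rewrite augmentation_linear mulrDl; congr (_ + _).
  by rewrite -[LHS]mulrA.
move: u; apply: qhom_linear_ext => [||p].
- exact: (linear_comp (@augmentation_linear k E x z) (compl _)).
- move=> c v1 v2; rewrite augmentation_linear mulrDr; congr (_ + _).
  exact: mulrCA.
rewrite pclassM !augmentation_pclass /= -natrM mulnb; congr (nat_of_bool _)%:R.
by case: (qseq q).
Qed.

Lemma augmentation_id x : augmentation (kid (x : C) : qhom R x x) = 1.
Proof. by rewrite (augmentation_pclass k (qpath1 (x : qvertex Q))). Qed.

Lemma augmentation_eq0 x y (u : qhom R x y) : x <> y -> augmentation u = 0.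
Proof.
move=> xy; move: u; apply: qhom_linear_ext => [||p].
- exact: augmentation_linear.
- by move=> c u v; rewrite scaler0 addr0.
rewrite augmentation_pclass; case: eqP => // p0.
by have := qpathP p; rewrite p0 /= => /eqP.
Qed.

Lemma fbc_isomorphic_eq (x y : C) : isomorphic_obj x y -> x = y.
Proof.
move=> [f [g [gf _]]]; apply: contrapT => xy.
have := augmentation_id x; rewrite -gf => /esym/eqP.
rewrite -[_ \oc _]/(qcomp g f) augmentationM (augmentation_eq0 f xy) mulr0.
by rewrite oner_eq0.
Qed.

Section RightIdeals.
Variables (x : C) (J : set (khom x x)).
Hypothesis J_ideal : right_ideal J.

Lemma right_ideal_submod : J 0 /\ forall (c : k) u v, J u -> J v -> J (c *: u + v).
Proof.
have [J0 JB JM] := J_ideal; split=> // c u v Ju Jv.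
have JN w : J w -> J (- w) by rewrite -[- w]sub0r; apply: JB.
rewrite -[v]opprK; apply: JB; last exact: JN.
have := JM _ (c *: kid x) Ju.
by rewrite (linear_mapZ (kcomp_linear u)) kcompf1.
Qed.

(** By descending induction on the length, J contains all paths p: modulo longer
    paths, j p is the multiple of p by the nonzero augmentation of j, and the
    paths of length at least D are zero. At length 0 this gives the identity. *)
Lemma right_ideal_full j : J j -> augmentation (j : qhom R x x) <> 0 -> J = setT.
Proof.
move=> Jj j0; have [_ _ JM] := J_ideal; have [J0 JP] := right_ideal_submod.
have [D DE] := long_paths_vanish k x.
have Jpath n : forall p : @qpath Q x x, (D <= size p + n)%N -> J (pclass R p).
  elim: n => [|n IHn] p.
    by rewrite addn0 => /DE ->.
  rewrite addnS => p_n.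
  (* S holds for every u, since it holds for the classes of paths. *)
  pose S (u : qhom R x x) : Prop :=
    J (qcomp u (pclass R p) - augmentation u *: pclass R p).
  have compr : linear (fun t : qhom R x x => qcomp t (pclass R p)).
    exact: (@kcomp_linearl k C x x x (pclass R p)).
  have S0 : S 0.
    rewrite /S (linear_map0 compr) (linear_map0 (@augmentation_linear k E x x)).
    by rewrite scale0r subrr.
  have SP (c : k) u v : S u -> S v -> S (c *: u + v).
    rewrite /S compr augmentation_linear => Su Sv.
    have := JP c _ _ Su Sv; congr (J _).
    by rewrite scalerBr scalerDl scalerA addrACA opprD.
  have Sj : S j.
    apply: (pclass_spanning (S := Subspace S0 SP)) => _ [q _ <-] /=.
    rewrite /S pclassM augmentation_pclass.
    have [q0|q_gt0] := eqVneq (qseq q) [::].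
      rewrite scale1r; have -> : qpath_cat q p = p by apply: val_inj; rewrite /= q0.
      by rewrite subrr.
    rewrite scale0r subr0; apply: IHn; rewrite /= size_cat.
    apply: leq_trans p_n _; rewrite -addnA -add1n leq_add2r.
    by move: q_gt0; rewrite -size_eq0 -lt0n.
  have Jjp : J (qcomp j (pclass R p)) by apply: JM.
  have := JP (- 1) _ _ Sj Jjp; rewrite scaleN1r opprB subrK => Jc.
  have := JP (augmentation (j : qhom R x x))^-1 _ _ Jc J0.
  by rewrite addr0 scalerA mulVf ?scale1r //; apply/eqP.
rewrite predeqE => u; split=> // _.
rewrite -[u]kcomp1f; apply: JM; apply: (Jpath D (qpath1 (x : qvertex Q))).
by rewrite leq_addl.
Qed.

End RightIdeals.

Lemma fbc_local_endo (x : C) : local_endo x.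
Proof.
pose M : set (khom x x) := [set u | augmentation (u : qhom R x x) = 0].
have M_ideal : right_ideal M.
  split=> [|u v Mu Mv|u v Mu]; rewrite /M /=.
  - exact: (linear_map0 (@augmentation_linear k E x x)).
  - by rewrite (linear_mapB (@augmentation_linear k E x x)) Mu Mv subrr.
  - by rewrite (augmentationM u v) Mu mul0r.
have M_proper : M <> setT.
  move=> MT; have : M (kid x) by rewrite MT.
  by rewrite /M /= augmentation_id => /eqP; rewrite oner_eq0.
have proper_sub J : right_ideal J -> J <> setT -> J `<=` M.
  move=> J_ideal J_proper j Jj; apply: contrapT => j0.
  by apply: J_proper; apply: right_ideal_full Jj j0.
exists M; split.
  split=> // J J_ideal MJ J_proper; apply/seteqP; split=> //.
  exact: proper_sub.
by move=> J [J_ideal J_proper J_max]; apply: J_max => //; apply: proper_sub.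
Qed.

End LocalEndomorphisms.

(** * Nakayama duality *)

Section NakayamaDuality.
Variables (k : fieldType) (E : fbc) (E_typeS : type_S E).

Notation Q := (fbc_quiver E).
Notation R := (@fbc_rel k E).
Notation C := (fbc_cat k E).

Section Pairing.
Variables (x y z : C).

Lemma pairing_linearl (u : khom x y) :
  linear (fun v : khom y z => pairing (v : qhom R y z) u).
Proof.
exact: (linear_comp (@trace_linear k E E_typeS x z) (@kcomp_linearl k C x y z u)).
Qed.

Lemma pairing_linearr (v : khom y z) :
  linear (fun u : khom x y => pairing v (u : qhom R x y)).
Proof.
exact: (linear_comp (@trace_linear k E E_typeS x z) (@kcomp_linear k C x y z v)).
Qed.

End Pairing.

Lemma nakayama_contra_iso (x : C) :
  contra_iso (hom_to (nakayama_obj x)) (dual_covar (hom_from x)).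
Proof.
exists (fun y : C => mk_linear (pairing_map_linear
  (@pairing_linearl x y (nakayama_obj x)) (@pairing_linearr x y (nakayama_obj x)))).
split=> [y|y z f u].
  apply: (@pairing_map_bijective _ _ _ _ _ _
    (@standard_classes k E y (nakayama_obj x)) (@standard_classes k E x y)).
  - exact: standard_classes_finite.
  - exact: standard_classes_spanning.
  - exact: standard_classes_right_dual.
  - exact: standard_classes_finite.
  - exact: standard_classes_spanning.
  - exact: standard_classes_left_dual.
apply: dual_ext => v; rewrite /dual_fun /= /pairing; congr trace.
by apply/esym; apply: (@kcompA k C).
Qed.

Lemma nakayama_covar_iso (x : C) :
  covar_iso (hom_from x) (dual_contra (hom_to (nakayama_obj x))).
Proof.
exists (fun y : C => mk_linear (pairing_map_linear
  (@pairing_linearr x y (nakayama_obj x)) (@pairing_linearl x y (nakayama_obj x)))).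
split=> [y|y z f u].
  apply: (@pairing_map_bijective _ _ _ _ _ _
    (@standard_classes k E x y) (@standard_classes k E y (nakayama_obj x))).
  - exact: standard_classes_finite.
  - exact: standard_classes_spanning.
  - exact: standard_classes_left_dual.
  - exact: standard_classes_finite.
  - exact: standard_classes_spanning.
  - exact: standard_classes_right_dual.
apply: dual_ext => v; rewrite /dual_fun /= /pairing; congr trace.
by apply: (@kcompA k C).
Qed.

Lemma nakayama_obj_surj (x : C) : exists y : C, nakayama_obj y = x.
Proof.
have [e ->] := vertex_ofP x; exists (vertex_of (gact (- (fd e)%:Z) e)).
rewrite nakayama_objE; congr vertex_of.
by rewrite /nakayama fd_gact -gactD subrr gact0.
Qed.

(** The second conjunct confines the nonzero dimensions to the finitely many
    objects that standard paths join to a given one. *)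
Lemma fbc_hom_dim (x y : C) : exists n, has_dim (khom x y) n /\
  (n <> 0%N -> @standard_classes k E x y !=set0).
Proof.
apply: (dual_has_dim (@pairing_linearr x y (nakayama_obj x))).
- exact: standard_classes_finite.
- exact: standard_classes_spanning.
- exact: standard_classes_left_dual.
Qed.

End NakayamaDuality.

Theorem theorem4p21 (k : fieldType) (E : fbc) (E_typeS : type_S E) :
  (forall x : fbc_cat k E,
     contra_iso (hom_to (nakayama_obj x)) (dual_covar (hom_from x))) /\
  locally_bounded_frobenius (fbc_cat k E).
Proof.
split; first exact: nakayama_contra_iso E_typeS.
split; first split.
- exact: fbc_local_endo.
- exact: fbc_isomorphic_eq.
- move=> x; have [d dE] := choice (fbc_hom_dim E_typeS x); exists d.
  split=> [y|]; first exact: (dE y).1.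
  by apply: sub_finite_set (standard_targets_finite k x) => y /(dE y).2.
- move=> x; have [d dE] := choice (fun y => fbc_hom_dim E_typeS y x); exists d.
  split=> [y|]; first exact: (dE y).1.
  by apply: sub_finite_set (standard_sources_finite k x) => y /(dE y).2.
move=> x; have [y yx] := nakayama_obj_surj x; exists y, (nakayama_obj x).
split; last exact: nakayama_covar_iso.
by rewrite -[x in hom_to x]yx; apply: nakayama_contra_iso.
Qed.
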